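(* Let $G$ be a simple loony endgame with exactly one 3-chain and at least one chain of length 4 or more, and let $c=cv(G)$. (a) If $c\ge2$ then $v(G)=c$. (b) If $c\le1$ and $c$ is even, then $v(G)=2$, except if $G$ has a 4-loop and $cv(G\backslash 4_\ell)=4$, in which case $v(G)=0$. (c) If $c\le1$ is odd and $v(G\backslash 3)=2$, then $v(G)=1$. (d) If $c\le1$ is odd, $v(G\backslash 3)\ne2$ and $G$ has no 4-loops, then $v(G)=3$. (e) If $c\le1$ is odd, $v(G\backslash3)\ne2$ and $G$ has $f\ge1$ 4-loops, let $K$ denote $G$ with all its 4-loops removed, and let $d$ be the integer with $0\le d\le7$ and $d\equiv v(K)\pmod 8$. If $f$ is odd then $v(G)=|4-d|$, and if $f$ is even then $v(G)=4-|4-d|$.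
   Context: Game. A dots and boxes game (position) $G$ consists of a finite set of unclaimed boxes and a finite set of undrawn lines, each undrawn line bordering either exactly one box or exactly two distinct boxes, each box being bordered by at least one and at most four undrawn lines. Two players play. The player to move draws (removes) an undrawn line; every box none of whose bordering lines is still undrawn is then claimed by that player. If the move claims at least one box the same player must move again (if a line remains); otherwise the other player moves. Claiming a box when possible is not compulsory. The game ends when no line remains. Each player maximises (own boxes) minus (opponent's boxes), counting only boxes claimed from $G$ onwards. Value. $v(G)$ is the net score, under optimal play, of the player who is NOT to move in $G$. Equivalently, $v(G)=0$ if $G$ has no undrawn lines, and otherwise $v(G)=\min_m v(G;m)$ over undrawn lines $m$, where, if drawing $m$ claims $k$ boxes and leaves the position $G_m$, then $v(G;m)=v(G_m)-k$ if $k\ge1$ and $v(G;m)=-v(G_m)$ if $k=0$. Chains and loops. An $n$-chain (denoted $n$) has boxes $b_1,\dots,b_n$ and lines $e_0,\dots,e_n$, where $e_i$ borders $b_i,b_{i+1}$ for $1\le i\le n-1$, $e_0$ borders only $b_1$ and $e_n$ borders only $b_n$. An $n$-loop ($n\ge4$, denoted $n_\ell$) has boxes $b_1,\dots,b_n$ and lines $e_1,\dots,e_n$, $e_i$ bordering $b_i,b_{i+1}$ (indices mod $n$). A simple loony endgame is a finite (possibly empty) disjoint union of chains of length at least 3 and loops of even length at least 4. $G\backslash 3$ (resp. $G\backslash 4_\ell$) is $G$ with one 3-chain (resp. one 4-loop) removed. Controlled value. If $G$ is a simple loony endgame with chains of lengths $c_i$ and loops of lengths $\ell_j$, then $fcv(G)=\sum_i(c_i-4)+\sum_j(\ell_j-8)$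 and $cv(G)=fcv(G)+tb(G)$, where the terminal bonus $tb(G)$ is: $0$ if $G$ is empty; $4$ if $G$ is non-empty and has a chain of length at least 4 or has no loops; $8$ if $G$ has loops but no chains; $6$ if $G$ has both chains and loops and all its chains are 3-chains. *)

(* Defs.v *)
From HB Require Import structures.
From mathcomp Require Import all_boot all_order all_algebra.
Set Implicit Arguments.
Unset Strict Implicit.
Unset Printing Implicit Defensive.
Import Order.TTheory GRing.Theory Num.Theory.

Definition line_degree (B L : finType) (borders : L -> B -> bool) (m : L) : nat :=
  #|[pred b | borders m b]|.

Definition box_degree (B L : finType) (borders : L -> B -> bool) (b : B) : nat :=
  #|[pred m | borders m b]|.

Record game := Game {
  box : finType;
  line : finType;
  borders : line -> box -> bool;
  line_degreeP : forall m, 1 <= line_degree borders m <= 2;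
  box_degreeP : forall b, 1 <= box_degree borders b <= 4 }.

Section Value.
Variable G : game.

(* A position reached from G is represented by its set S of undrawn lines; its
   unclaimed boxes are those that still have an undrawn bordering line. *)
Definition unclaimed (S : {set line G}) : {set box G} :=
  [set b | [exists m in S, borders m b]].

Definition claims (S : {set line G}) (m : line G) : nat :=
  #|unclaimed S :\: unclaimed (S :\ m)|.

Definition seq_min (s : seq int) : int :=
  if s is x :: s' then foldr Num.min x s' else 0%R.

(* n is the number of undrawn lines of S; see value_atE. *)
Fixpoint value_rec (n : nat) (S : {set line G}) : int :=
  if n is n'.+1 then
    seq_min [seq (let w := value_rec n' (S :\ m) in
                  let k := claims S m in
                  if 1 <= k then (w - k%:Z)%R else (- w)%R) | m <- enum S]
  else 0%R.

Definition value_at (S : {set line G}) : int := value_rec #|S| S.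

(* The net score of the player not to move, all lines of G being undrawn. *)
Definition value : int := value_at setT.

Definition move_value (S : {set line G}) (m : line G) : int :=
  let w := value_at (S :\ m) in
  let k := claims S m in
  if 1 <= k then (w - k%:Z)%R else (- w)%R.

Lemma value_atE (S : {set line G}) :
  value_at S = seq_min [seq move_value S m | m <- enum S].
Proof.
rewrite {1}/value_at; case E: #|S| => [|n] /=.
  by move/eqP: E; rewrite cards_eq0 => /eqP ->; rewrite enum_set0.
congr seq_min; apply/eq_in_map => m; rewrite mem_enum => mS.
rewrite /move_value /value_at.
by move: E; rewrite (cardsD1 m) mS add1n => -[->].
Qed.

Lemma value_at0 : value_at set0 = 0%R.
Proof. by rewrite value_atE enum_set0. Qed.

Lemma seq_minP (s : seq int) :
  s != [::] -> seq_min s \in s /\ {in s, forall x, (seq_min s <= x)%R}.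
Proof.
case: s => //= x s _; elim: s => /= [|y s [IHin IHle]].
  by split=> [|y]; rewrite inE // => /eqP ->.
split.
  rewrite minElt; case: ifP => _; first by rewrite !inE eqxx orbT.
  by move: IHin; rewrite !inE => /orP[->|->]; rewrite ?orbT.
move=> z; rewrite !inE orbCA ge_min => /orP[/eqP ->|zs]; first by rewrite lexx.
by rewrite (IHle z) ?inE // orbT.
Qed.

Lemma value_at_attained (S : {set line G}) :
  S != set0 -> exists2 m, m \in S & value_at S = move_value S m.
Proof.
move=> S0; rewrite value_atE.
have /seq_minP[/mapP[m mS ->] _] : [seq move_value S m | m <- enum S] != [::].
  by rewrite -size_eq0 size_map -cardE cards_eq0.
by exists m => //; rewrite -mem_enum.
Qed.

Lemma value_at_le (S : {set line G}) m :
  m \in S -> (value_at S <= move_value S m)%R.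
Proof.
move=> mS; rewrite value_atE.
have mm : move_value S m \in [seq move_value S m | m <- enum S].
  by rewrite map_f // mem_enum.
by have [|_ ->] := @seq_minP [seq move_value S m | m <- enum S];
  rewrite // -size_eq0 -lt0n; case: [seq _ | _ <- _] mm.
Qed.

End Value.

Lemma card_ord_le n (P : pred 'I_n) (s : seq nat) :
  (forall j, P j -> val j \in s) -> #|P| <= size s.
Proof.
move=> Ps; pose t : seq 'I_n := pmap insub s.
have /subset_leq_card/leq_trans : P \subset t.
  by apply/subsetP => j Pj; rewrite mem_pmap_sub Ps.
apply; apply: leq_trans (card_size _) _.
by rewrite size_pmap_sub count_size.
Qed.

Lemma card_gt0 (T : finType) (P : pred T) x : P x -> 0 < #|P|.
Proof. by move=> Px; apply/card_gt0P; exists x. Qed.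

(* Boxes are numbered from 0: the ordinal j stands for b_{j+1}. *)
Definition chain_borders n (i : 'I_n.+1) (j : 'I_n) : bool :=
  (i == j :> nat) || (i == j.+1 :> nat).

Lemma chain_line_degreeP n (i : 'I_n.+2) :
  1 <= line_degree (@chain_borders n.+1) i <= 2.
Proof.
apply/andP; split.
  case: (ltnP i n.+1) => [lt_in|le_ni].
    by apply: (@card_gt0 _ _ (Ordinal lt_in)); rewrite /= /chain_borders eqxx.
  apply: (@card_gt0 _ _ ord_max); rewrite /= /chain_borders /=.
  by rewrite [_ == n.+1]eqn_leq le_ni -ltnS ltn_ord orbT.
apply: (@card_ord_le _ _ [:: val i; i.-1]) => j /=.
by rewrite /chain_borders !inE => /orP[/eqP->|/eqP->]; rewrite eqxx ?orbT.
Qed.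

Lemma chain_box_degreeP n (j : 'I_n) :
  1 <= box_degree (@chain_borders n) j <= 4.
Proof.
apply/andP; split.
  have lt_j : j < n.+1 by rewrite ltnW // ltnS.
  by apply: (@card_gt0 _ _ (Ordinal lt_j)); rewrite /= /chain_borders eqxx.
apply: leq_trans (_ : 2 <= 4) => //.
apply: (@card_ord_le _ _ [:: val j; j.+1]) => i /=.
by rewrite /chain_borders !inE.
Qed.

Definition chain_succ n : game :=
  Game (@chain_line_degreeP n) (@chain_box_degreeP n.+1).

Definition loop_borders n (i j : 'I_n) : bool :=
  (j == i :> nat) || (j == i.+1 %% n :> nat).

Lemma loop_line_degreeP n (i : 'I_n) :
  1 <= line_degree (@loop_borders n) i <= 2.
Proof.
apply/andP; split.
  by apply: (@card_gt0 _ _ i); rewrite /= /loop_borders eqxx.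
apply: (@card_ord_le _ _ [:: val i; i.+1 %% n]) => j /=.
by rewrite /loop_borders !inE.
Qed.

Lemma loop_box_degreeP n (j : 'I_n) :
  1 <= box_degree (@loop_borders n) j <= 4.
Proof.
apply/andP; split.
  by apply: (@card_gt0 _ _ j); rewrite /= /loop_borders eqxx.
apply: leq_trans (_ : 2 <= 4) => //.
apply: (@card_ord_le _ _ [:: val j; (j + n.-1) %% n]) => i /=.
rewrite /loop_borders !inE => /orP[/eqP->|/eqP->]; first by rewrite eqxx.
have n0 : 0 < n by apply: leq_ltn_trans (ltn_ord i).
by apply/orP; right; rewrite modnDml addSnnS prednK // modnDr modn_small.
Qed.

Definition loop n : game := Game (@loop_line_degreeP n) (@loop_box_degreeP n).

Section Union.
Variables G H : game.

Definition union_borders (m : line G + line H) (b : box G + box H) : bool :=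
  match m, b with
  | inl m, inl b => borders m b
  | inr m, inr b => borders m b
  | _, _ => false
  end.

Lemma card_sum_pred (A B : finType) (P : pred (A + B)) :
  #|P| = #|[pred x | P (inl x)]| + #|[pred x | P (inr x)]|.
Proof. by rewrite -!sum1_card big_sumType. Qed.

Lemma union_line_degreeP m : 1 <= line_degree union_borders m <= 2.
Proof.
rewrite /line_degree card_sum_pred; case: m => m /=.
  by rewrite [X in _ + X]eq_card0 // addn0 line_degreeP.
by rewrite [X in X + _]eq_card0 // line_degreeP.
Qed.

Lemma union_box_degreeP b : 1 <= box_degree union_borders b <= 4.
Proof.
rewrite /box_degree card_sum_pred; case: b => b /=.
  by rewrite [X in _ + X]eq_card0 // addn0 box_degreeP.
by rewrite [X in X + _]eq_card0 // box_degreeP.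
Qed.

Definition union : game := Game union_line_degreeP union_box_degreeP.

End Union.

Lemma empty_line_degreeP (m : void) :
  1 <= line_degree (fun _ _ : void => false) m <= 2.
Proof. by case: m. Qed.

Lemma empty_box_degreeP (b : void) :
  1 <= box_degree (fun _ _ : void => false) b <= 4.
Proof. by case: b. Qed.

Definition empty_game : game := Game empty_line_degreeP empty_box_degreeP.

(* There is no 0-chain (its line would border no box): the value at 0 is junk. *)
Definition chain n : game := if n is n'.+1 then chain_succ n' else empty_game.

(* The multisets of chain lengths and of loop lengths, as lists. *)
Record simple_loony_endgame := SimpleLoonyEndgame {
  chains : seq nat;
  loops : seq nat;
  chains_ok : all (fun c => 3 <= c) chains;
  loops_ok : all (fun l => (4 <= l) && ~~ odd l) loops }.

Definition endgame_game (G : simple_loony_endgame) : game :=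
  foldr union empty_game (map chain (chains G) ++ map loop (loops G)).

Definition v (G : simple_loony_endgame) : int := value (endgame_game G).

Lemma all_rem (T : eqType) (P : pred T) x (s : seq T) :
  all P s -> all P (rem x s).
Proof. by move/allP=> Ps; apply/allP=> y /mem_rem/Ps. Qed.

Lemma all_filter_sub (T : Type) (P Q : pred T) (s : seq T) :
  all P s -> all P (filter Q s).
Proof. by rewrite all_filter; apply: sub_all => x /= ->; rewrite implybT. Qed.

(* One n-chain is removed; G is unchanged if it has none. *)
Definition remove_chain (n : nat) (G : simple_loony_endgame) :=
  SimpleLoonyEndgame (all_rem n (chains_ok G)) (loops_ok G).

(* One n-loop is removed; G is unchanged if it has none. *)
Definition remove_loop (n : nat) (G : simple_loony_endgame) :=
  SimpleLoonyEndgame (chains_ok G) (all_rem n (loops_ok G)).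

Definition remove_all_loops (n : nat) (G : simple_loony_endgame) :=
  SimpleLoonyEndgame (chains_ok G) (all_filter_sub (predC1 n) (loops_ok G)).

Definition fcv (G : simple_loony_endgame) : int :=
  (\sum_(c <- chains G) (c%:Z - 4) + \sum_(l <- loops G) (l%:Z - 8))%R.

Definition tb (G : simple_loony_endgame) : int :=
  if (chains G == [::]) && (loops G == [::]) then 0%R
  else if has (fun c => 4 <= c) (chains G) || (loops G == [::]) then 4%R
  else if chains G == [::] then 8%R
  else 6%R.

Definition cv (G : simple_loony_endgame) : int := (fcv G + tb G)%R.

(* Main.v *)
(* A string (a chain with one end line drawn) of n boxes next to a position X in
   which no box can be claimed is worth n - 2 + |v(X) - 2| to the player to move: he
   either takes everything, or takes n - 2 boxes and gives the last two away together
   with the obligation to move in X.  A cut loop is worth n - 4 + |v(X) - 4| likewise.  Hence v(G) is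
   the minimum over the components C of n - q + |v(G \ C) - q|, with q = 2 for chains and
   q = 4 for loops.  This recursion gives v >= fcv + 4 for non-empty endgames; without
   3-chains and with a chain, opening a shortest loop shows v = cv if cv >= 2 and v <= 4
   otherwise.  Opening the 3-chain gives v(G) <= 1 + |v(G \ 3) - 2|, and only the opening of
   a 4-loop can do better, which yields the corollary by induction on the number of
   4-loops. *)
Require Import Defs.
From mathcomp Require Import all_boot all_order all_algebra.
From mathcomp Require Import zify.
Import Order.TTheory GRing.Theory Num.Theory.
Local Open Scope ring_scope.
Set Implicit Arguments.
Unset Strict Implicit.
Unset Printing Implicit Defensive.

(** * Taking and giving boxes along a strip of boxes *)

(** Facing a string with rest X, the mover has two plans, worth n - v(X) and n - 4 + v(X); n - 2 +
    |v(X) - 2| is their maximum. For a cut loop the second plan is worth n - 8 + v(X), two pairs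
    being given away. These plans work whatever X is. The harder half is that nothing beats them:
    the mover may interrupt the string to play in X, after which X may offer captures. But such a
    move claims nothing and leaves the strip to the opponent, who secures at least n - 2 >= 0 (n - 4
    >= 0 for a cut loop) by the first half, so no induction over X arises. All of this happens among
    sets of lines of one fixed game. Components are enumerations of lines and boxes by natural
    numbers, so that opening, shortening and reversing them are reindexings without change of type.
    Small values are pinned down by parity: v(G) and fcv(G) agree modulo 2. Opening a 4-loop
    replaces x by |x - 4|, which on 0, ..., 4 is the involution x -> 4 - x; two 4-loops cancel there
    but shift cv by 8, hence the residue modulo 8. *)

Section Positions.
Variable g : game.
Implicit Types (S X : {set line g}) (m d : line g) (x : box g).
Implicit Types (e : nat -> line g) (b : nat -> box g) (n i j : nat).

Definition sole S m x := borders m x && [forall (m' | m' \in S), borders m' x ==> (m' == m)].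

Lemma soleP S m x :
  reflect (borders m x /\ forall m', m' \in S -> borders m' x -> m' = m) (sole S m x).
Proof.
apply: (iffP andP) => [[mx /forall_inP h]|[mx h]]; split=> //.
  by move=> m' m'S m'x; apply/eqP; have := h _ m'S; rewrite m'x.
by apply/forall_inP => m' m'S; apply/implyP => m'x; apply/eqP/h.
Qed.

Lemma claimsE S m : m \in S -> claims S m = #|[pred x | sole S m x]|.
Proof.
move=> mS; apply: eq_card => x; rewrite !inE; apply/andP/soleP.
  case=> /exists_inP h /exists_inP[m1 m1S m1x].
  have uniq_m m' : m' \in S -> borders m' x -> m' = m.
    move=> m'S m'x; apply/eqP/negP => /negP ne; apply: h.
    by exists m' => //; rewrite !inE ne.
  by split=> //; rewrite -(uniq_m _ m1S m1x).
case=> mx h; split; last by apply/exists_inP; exists m.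
apply/exists_inP => -[m']; rewrite !inE => /andP[ne m'S] m'x.
by rewrite (h _ m'S m'x) eqxx in ne.
Qed.

Lemma value_at_capture S m : m \in S -> (0 < claims S m)%N ->
  value_at S <= value_at (S :\ m) - (claims S m)%:Z.
Proof. by move=> mS c0; have := value_at_le mS; rewrite /move_value c0. Qed.

Lemma value_at_quiet S m : m \in S -> claims S m = 0%N ->
  value_at S <= - value_at (S :\ m).
Proof. by move=> mS c0; have := value_at_le mS; rewrite /move_value c0. Qed.

Lemma le_value_at S (a : int) : S != set0 ->
  (forall m, m \in S -> a <= move_value S m) -> a <= value_at S.
Proof. by move=> /value_at_attained[m mS ->]; apply. Qed.

(* A move elsewhere never beats taking an isolated line: whatever it achieves, it achieves
   without that line. *)
Lemma value_at_isolated S d : d \in S -> (forall x, borders d x -> sole S d x) ->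
  value_at S = value_at (S :\ d) - (claims S d)%:Z.
Proof.
move=> dS iso.
have claims_deg (T : {set line g}) : d \in T -> (forall x, borders d x -> sole T d x) ->
    claims T d = line_degree (@borders g) d.
  move=> dT isoT; rewrite claimsE //; apply: eq_card => x; rewrite !inE.
  by apply/idP/idP => [/soleP[]|/isoT].
rewrite claims_deg //; elim: {S}#|S| {-2}S (leqnn #|S|) dS iso => [|n IHn] S.
  by rewrite leqn0 cards_eq0 => /eqP->; rewrite inE.
move=> cS dS iso; have deg0 : (0 < line_degree (@borders g) d)%N.
  by case/andP: (line_degreeP d).
apply/eqP; rewrite eq_le; apply/andP; split.
  by have := value_at_capture dS; rewrite claims_deg //; apply.
apply: le_value_at => [|m mS]; first by apply/set0Pn; exists d.
have [->|ne] := eqVneq m d; first by rewrite /move_value claims_deg // deg0.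
have mSd : m \in S :\ d by rewrite !inE ne.
have dSm : d \in S :\ m by rewrite !inE eq_sym ne.
have cE : claims (S :\ d) m = claims S m.
  rewrite !claimsE //; apply: eq_card => x; rewrite !inE; apply/soleP/soleP => -[mx h].
    split=> // m' m'S m'x; have [m'd|ne'] := eqVneq m' d; last by apply: h; rewrite // !inE ne'.
    by rewrite m'd in m'x *; have /soleP[_ hd] := iso _ m'x; rewrite (hd m).
  by split=> // m'; rewrite !inE => /andP[_]; apply: h.
have IH : value_at (S :\ m) = value_at (S :\ m :\ d) - (line_degree (@borders g) d)%:Z.
  apply: IHn => // [|x dx].
    by move: cS; rewrite (cardsD1 m) mS.
  have /soleP[_ h] := iso _ dx; apply/soleP; split=> // m'.
  by rewrite !inE => /andP[_]; apply: h.
have := value_at_le mSd; rewrite /move_value cE IH.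
have -> : S :\ m :\ d = S :\ d :\ m by apply/setP=> z; rewrite !inE andbCA.
by case: ifP => _ ?; lia.
Qed.

(* Box j lies between lines e j and e (j + 1).  Line e 0 has been drawn; the others may be. *)
Record strip S e b n : Prop := Strip {
  strip_open : e 0%N \notin S;
  strip_box : forall j m, (j < n)%N -> m \in S ->
    borders m (b j) = (m == e j) || (m == e j.+1);
  strip_line : forall i x, (0 < i <= n)%N -> e i \in S -> borders (e i) x ->
    x = b i.-1 \/ (i < n)%N /\ x = b i;
  strip_lineI : forall i j, (0 < i <= n)%N -> (0 < j <= n)%N -> e i = e j -> i = j;
  strip_boxI : forall i j, (i < n)%N -> (j < n)%N -> b i = b j -> i = j }.

Lemma strip_sub S X e b n : X \subset S -> strip S e b n -> strip X e b n.
Proof.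
move=> /subsetP XS [h0 h1 h2 h3 h4]; split=> //.
- by apply: contra h0; apply: XS.
- by move=> j m jn /XS; apply: h1.
- by move=> i x hi /XS; apply: h2.
Qed.

Lemma strip_shift S e b n : strip S e b n.+1 -> e 1%N \notin S ->
  strip S (fun i => e i.+1) (fun j => b j.+1) n.
Proof.
case=> h0 h1 h2 h3 h4 e1; split=> //.
- by move=> j m jn; apply: h1.
- by case=> // i x hi eS ex; apply: (h2 i.+2).
- by move=> i j hi hj /h3 h; apply/succn_inj/h; lia.
- by move=> i j hi hj /h4 h; apply/succn_inj/h; lia.
Qed.

Lemma strip_trunc S e b n : strip S e b n.+1 -> e n \notin S -> strip S e b n.
Proof.
case=> h0 h1 h2 h3 h4 en; split=> //.
- by move=> j m jn; apply: h1; lia.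
- move=> i x hi eS ex; case: (h2 i x _ eS ex) => [|->|[_ xb]]; [lia|by left|].
  right; split=> //; rewrite ltn_neqAle andbC; case/andP: hi => _ -> /=.
  by apply: contraNneq en => <-.
- by move=> i j hi hj; apply: h3; lia.
- by move=> i j hi hj; apply: h4; lia.
Qed.

Lemma strip_next S e b n i : strip S e b n -> (0 < i < n)%N -> e i.+1 != e i.
Proof. by case=> _ _ _ h _ hi; apply/eqP => /h; lia. Qed.

Lemma strip_prev S e b n i : strip S e b n -> (0 < i <= n)%N -> e i \in S -> e i.-1 != e i.
Proof.
case: i => [|[|i]] // st hi eS; first by apply: contraNneq (strip_open st) => ->.
by rewrite eq_sym; apply: (strip_next st).
Qed.

Lemma strip_sole_prev S e b n i : strip S e b n -> (0 < i <= n)%N -> e i \in S ->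
  sole S (e i) (b i.-1) = (e i.-1 \notin S).
Proof.
move=> st hi eS; have ne := strip_prev st hi eS; case: i hi eS ne => // i hi eS ne.
apply/soleP/idP => [[_ h]|h].
  by apply: contra ne => iS; apply/eqP/h; rewrite // (strip_box st) ?eqxx //; lia.
split=> [|m mS]; rewrite (strip_box st) ?eqxx ?orbT //.
by case/orP=> /eqP // mi; rewrite -mi mS in h.
Qed.

Lemma strip_sole_next S e b n i : strip S e b n -> (0 < i < n)%N -> e i \in S ->
  sole S (e i) (b i) = (e i.+1 \notin S).
Proof.
move=> st hi eS; have ne := strip_next st hi.
apply/soleP/idP => [[_ h]|h].
  by apply: contra ne => iS; apply/eqP/h; rewrite // (strip_box st) ?eqxx ?orbT //; lia.
split=> [|m mS]; rewrite (strip_box st) ?eqxx ?orbT //; try lia.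
by case/orP=> /eqP // mi; rewrite -mi mS in h.
Qed.

Lemma strip_claims S e b n i : strip S e b n -> (0 < i <= n)%N -> e i \in S ->
  claims S (e i) = ((e i.-1 \notin S) + ((i < n) && (e i.+1 \notin S)))%N.
Proof.
move=> st hi eS; rewrite claimsE //.
rewrite -cardsE (cardsD1 (b i.-1)) !inE (strip_sole_prev st) //; congr addn.
case: ltnP => [lt|le] /=.
  rewrite (cardsD1 (b i)) !inE (strip_sole_next st) ?lt ?andbT; [|lia|done].
  have -> : b i != b i.-1 by apply/eqP => /(strip_boxI st); lia.
  rewrite -[RHS]addn0; congr addn; apply/eqP; rewrite cards_eq0 -subset0.
  apply/subsetP => x; rewrite !inE => /and3P[x1 x2 /soleP[ex _]].
  by case: (strip_line st hi eS ex) x1 x2 => [->|[_ ->]]; rewrite eqxx.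
apply/eqP; rewrite cards_eq0 -subset0.
apply/subsetP => x; rewrite !inE => /andP[x1 /soleP[ex _]].
by case: (strip_line st hi eS ex) x1 => [->|[]]; [rewrite eqxx|lia].
Qed.

Lemma strip_isolated S e b n i : strip S e b n -> (0 < i <= n)%N -> e i \in S ->
  e i.-1 \notin S -> (n <= i)%N || (e i.+1 \notin S) ->
  value_at S = value_at (S :\ e i) - (1 + (i < n))%N%:Z.
Proof.
move=> st hi eS p q; rewrite (value_at_isolated eS) //.
  rewrite (strip_claims st) // p; congr (_ - (Posz (addn _ _))).
  by case: ltnP q => //= _ ->.
move=> x ex; case: (strip_line st hi eS ex) => [->|[lt ->]].
  by rewrite (strip_sole_prev st).
rewrite (strip_sole_next st) //; last by lia.
by move: q; rewrite leqNgt lt.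
Qed.

Definition strip_lines e n : {set line g} := [set e i.+1 | i : 'I_n].

Lemma mem_strip_lines e n m :
  reflect (exists2 i, (0 < i <= n)%N & m = e i) (m \in strip_lines e n).
Proof.
apply: (iffP imsetP) => [[i _ ->]|[[|i] // hi ->]]; first by exists i.+1; rewrite ?ltn_ord.
by exists (Ordinal (hi : i < n)%N).
Qed.

Lemma setD_strip_lines S e n :
  S :\: strip_lines e n.+1 = (S :\ e 1%N) :\: strip_lines (fun i => e i.+1) n.
Proof.
rewrite setDDl; congr (_ :\: _); apply/setP => m; rewrite in_setU1.
apply/idP/orP => [/mem_strip_lines[[|[|i]] // hi ->]|[/eqP->|/mem_strip_lines[i hi ->]]].
- by left.
- by right; apply/mem_strip_lines; exists i.+1.
- by apply/mem_strip_lines; exists 1%N.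
- by apply/mem_strip_lines; exists i.+1 => //; lia.
Qed.

(** Greedy play from the open end keeps the turn: with [e 0] gone, [e 1] captures if it is undrawn,
    and the strip starting at [e 1] is then open. The sum counts the boxes of the strip that are
    still unclaimed. *)
Lemma strip_take S e b n : strip S e b n ->
  value_at S <= value_at (S :\: strip_lines e n) -
                (\sum_(j < n) ((e j \in S) || (e j.+1 \in S)))%N%:Z.
Proof.
elim: n S e b => [|n IHn] S e b st.
  rewrite big_ord0 subr0; suff -> : S :\: strip_lines e 0 = S by [].
  by apply/setP => m; rewrite inE; case: mem_strip_lines => // -[i]; lia.
have st1 : strip (S :\ e 1%N) (fun i => e i.+1) (fun j => b j.+1) n.
  apply: strip_shift; last by rewrite !inE eqxx.
  by apply: strip_sub st; rewrite subD1set.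
have := IHn _ _ _ st1; rewrite -setD_strip_lines big_ord_recl /= (negPf (strip_open st)) /=.
case e1S: (e 1%N \in S); last first.
  suff -> : S :\ e 1%N = S by rewrite add0n.
  by apply/setP => m; rewrite !inE; case: eqVneq => // ->; rewrite e1S.
have := value_at_capture e1S; rewrite (strip_claims st) //= (strip_open st) /= => /(_ isT).
set A := value_at (S :\ _); set B := value_at _ => hA hB.
(* When [e 2] is already drawn, [e 1] claims the second box as well, and that box is no longer
   counted in the remaining strip. *)
suff : (((1 < n.+1) && (e 2 \notin S)) +
      \sum_(i < n) ((e i.+1 \in S :\ e 1) || (e i.+2 \in S :\ e 1)) =
    \sum_(i < n) ((e (bump 0 i) \in S) || (e (bump 0 i).+1 \in S)))%N.
  move=> <-; rewrite addnA PoszD; move: hA hB.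
  by move: (Posz (1 + _)) (Posz (\sum_(i < n) _)) => p s; lia.
case: n {IHn hB A B hA} st {st1} => [|n] st; first by rewrite !big_ord0.
rewrite !big_ord_recl /= !inE eqxx e1S /= (strip_next st) //= addnA.
congr addn; first by case: (_ \in _).
apply: eq_bigr => i _; rewrite /bump !add1n !inE.
have h k : (0 < k)%N -> (k <= n.+1)%N -> e k.+1 != e 1%N.
  by move=> k0 kn; apply/eqP => /(strip_lineI st); lia.
by rewrite !h //; have := ltn_ord i; lia.
Qed.

Lemma strip_take_all S e b n : strip S e b n ->
  (forall j, (j < n)%N -> (e j \in S) || (e j.+1 \in S)) ->
  value_at S <= value_at (S :\: strip_lines e n) - n%:Z.
Proof.
move=> /strip_take + h; rewrite (eq_bigr (fun => 1%N)) => [|j _]; last by rewrite h.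
by rewrite sum1_card card_ord.
Qed.

Lemma strip_remove_first S e b n : strip S e b n.+1 ->
  strip (S :\ e 1%N) (fun i => e i.+1) (fun j => b j.+1) n.
Proof.
by move=> st; apply: strip_shift; [apply: strip_sub st; rewrite subD1set|rewrite !inE eqxx].
Qed.

Lemma strip_neq S e b n i j : strip S e b n -> (0 < i <= n)%N -> (0 < j <= n)%N ->
  i != j -> e i != e j.
Proof. by move=> st hi hj; apply: contraNneq => /(strip_lineI st hi hj) ->. Qed.

Lemma strip_remove S e b n i j : strip S e b n -> (0 < i <= n)%N -> (0 < j <= n)%N ->
  i != j -> (e j \in S :\ e i) = (e j \in S).
Proof.
by move=> st hi hj ij; rewrite !inE (strip_neq st hj hi) // eq_sym.
Qed.

(* A string is a strip whose other end line is undrawn.  The mover takes n - 2 boxes and draws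
   that end line, which leaves the last two boxes to be claimed by a single move. *)
Lemma string_value_le S e b n : strip S e b n ->
  (forall i, (0 < i <= n)%N -> e i \in S) -> (2 <= n)%N ->
  value_at S <= 4 - n%:Z - value_at (S :\: strip_lines e n).
Proof.
case: n => [|[|n]] //; elim: n S e b => [|n IHn] S e b st eS _.
  have e1 := eS 1%N isT; have e2 := eS 2%N isT.
  have c2 : claims S (e 2%N) = 0%N by rewrite (strip_claims st) //= e1.
  have st2 : strip (S :\ e 2%N) e b 2 by apply: strip_sub st; rewrite subD1set.
  have := value_at_quiet e2 c2.
  rewrite (strip_isolated (i := 1) st2) ?setD11 ?(strip_open st2) ?(strip_remove st) //.
  suff -> : S :\ e 2%N :\ e 1%N = S :\: strip_lines e 2 by lia.
  rewrite !setD_strip_lines; apply/setP => m; rewrite !inE.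
  case: mem_strip_lines => [[i]|_]; first by lia.
  by rewrite andbCA.
have e1 := eS 1%N isT; have e2 := eS 2%N isT.
have := value_at_capture e1; rewrite (strip_claims st) // (strip_open st) e2 andbF /= => /(_ isT).
have /IHn := strip_remove_first st; rewrite -setD_strip_lines.
have h i : (0 < i <= n.+2)%N -> e i.+1 \in S :\ e 1.
  by move=> hk; rewrite (strip_remove st) ?eS; lia.
by move=> /(_ h isT); lia.
Qed.

(* In a loose strip both end lines are drawn.  The mover takes n - 4 boxes and draws the middle
   line of the rest, which leaves two pairs of boxes. *)
Lemma loose_strip_value_le S e b n : strip S e b n ->
  (forall i, (0 < i < n)%N -> e i \in S) -> e n \notin S -> (4 <= n)%N ->
  value_at S <= 8 - n%:Z - value_at (S :\: strip_lines e n).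
Proof.
case: n => [|[|[|[|n]]]] //; elim: n S e b => [|n IHn] S e b st eS en _.
  have e1 := eS 1%N isT; have e2 := eS 2%N isT; have e3 := eS 3%N isT.
  have c2 : claims S (e 2%N) = 0%N by rewrite (strip_claims st) //= e1 e3.
  have st2 : strip (S :\ e 2%N) e b 4 by apply: strip_sub st; rewrite subD1set.
  have st21 : strip (S :\ e 2%N :\ e 1%N) e b 4 by apply: strip_sub st2; rewrite subD1set.
  have := value_at_quiet e2 c2.
  rewrite (strip_isolated (i := 1) st2) ?setD11 ?(strip_open st2) ?(strip_remove st) //.
  rewrite (strip_isolated (i := 3) st21) ?(strip_remove st2) ?setD11 ?(strip_remove st)
    ?(negPf en) //.
  suff -> : S :\ e 2%N :\ e 1%N :\ e 3%N = S :\: strip_lines e 4 by lia.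
  rewrite !setD_strip_lines; apply/setP => m; rewrite !inE.
  case: mem_strip_lines => [[i]|_]; first by lia.
  have [->|ne] := eqVneq m (e 4%N); first by rewrite (negPf en) !andbF.
  by case: (m == e 1%N); case: (m == e 2%N); case: (m == e 3%N).
have e1 := eS 1%N isT; have e2 := eS 2%N isT.
have := value_at_capture e1; rewrite (strip_claims st) // (strip_open st) e2 andbF /= => /(_ isT).
have /IHn := strip_remove_first st; rewrite -setD_strip_lines.
have h i : (0 < i < n.+4)%N -> e i.+1 \in S :\ e 1.
  by move=> hk; rewrite (strip_remove st) ?eS; lia.
have h' : e n.+4.+1 \notin S :\ e 1 by rewrite !inE (negPf en) andbF.
by move=> /(_ h h' isT); lia.
Qed.

(** * Opened components next to a rest without captures *)

Definition capture_free X := forall m x, m \in X -> borders m x ->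
  exists m', [/\ m' \in X, m' != m & borders m' x].

Lemma capture_free_claims S X m : X \subset S -> capture_free X -> m \in X ->
  claims S m = 0%N.
Proof.
move=> /subsetP XS cf mX; rewrite claimsE ?XS //; apply: eq_card0 => x; rewrite !inE.
apply/negP => /soleP[mx h]; have [m' [m'X ne m'x]] := cf _ _ mX mx.
by rewrite (h m' (XS _ m'X) m'x) eqxx in ne.
Qed.

Lemma capture_free_move S X m : X \subset S -> capture_free X -> m \in X ->
  move_value S m = - value_at (S :\ m).
Proof. by move=> XS cf mX; rewrite /move_value (capture_free_claims XS). Qed.

Lemma setDD1 S X m : (S :\ m) :\: X = (S :\: X) :\ m.
Proof. by apply/setP => z; rewrite !inE andbCA. Qed.

Lemma setDD1l S X m : m \in X -> (S :\ m) :\: X = S :\: X.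
Proof.
move=> mX; apply/setP => z; rewrite !inE.
by have [->|] := eqVneq z m; rewrite ?mX.
Qed.

Lemma mem_strip e n i : (0 < i <= n)%N -> e i \in strip_lines e n.
Proof. by move=> hi; apply/mem_strip_lines; exists i. Qed.

(* Drawing an interior line claims nothing and lets the opponent take the whole strip. *)
Lemma strip_move_interior S e b n i : strip S e b n -> (1 < i <= n)%N ->
  (forall j, (0 < j < n)%N -> e j \in S) -> e i \in S ->
  (i.+1 < n)%N || (e n \in S) ->
  n%:Z - value_at (S :\: strip_lines e n) <= move_value S (e i).
Proof.
move=> st hi eS ei hn; rewrite /move_value (strip_claims st) //; try lia.
have -> : e i.-1 \in S by apply: eS; lia.
have -> : ((i < n) && (e i.+1 \notin S))%N = false.
  case: ltnP => //= lt; apply/negbTE; rewrite negbK.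
  case/orP: hn => [h|]; first by apply: eS; lia.
  case: (ltnP i.+1 n) => ?; first by move=> _; apply: eS; lia.
  by have -> : i.+1 = n by lia.
rewrite /=; have sti : strip (S :\ e i) e b n by apply: strip_sub st; rewrite subD1set.
have := strip_take_all sti; rewrite setDD1l; last by apply: mem_strip; lia.
move=> h; suff : value_at (S :\ e i) <= value_at (S :\: strip_lines e n) - n%:Z by lia.
apply: h => -[|j] jn.
  by rewrite orbC (strip_remove st) ?eS //; lia.
have [ij|ne] := eqVneq i j.+1.
  rewrite orbC (strip_remove st); try lia.
  case: (ltnP j.+2 n) => h; first by rewrite eS //; lia.
  have E : n = j.+2 by lia.
  by case/orP: hn => [|eSn]; [lia|rewrite -E eSn].
by rewrite (strip_remove st) ?eS //; lia.
Qed.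

(** The better of taking everything and giving away the last two boxes. The rest is arbitrary here,
    which is what allows the use of this bound after the other player has moved in the rest. *)
Lemma string_value_le_cost S e b n : strip S e b n ->
  (forall i, (0 < i <= n)%N -> e i \in S) -> (2 <= n)%N ->
  n%:Z - 2 + `|value_at (S :\: strip_lines e n) - 2| <= - value_at S.
Proof.
move=> st eS n2; have := string_value_le st eS n2.
have h1 := strip_take_all st; move=> h2.
have : value_at S <= value_at (S :\: strip_lines e n) - n%:Z.
  by apply: h1 => j jn; rewrite orbC eS //; lia.
by lia.
Qed.

Lemma loose_strip_value_le_cost S e b n : strip S e b n ->
  (forall i, (0 < i < n)%N -> e i \in S) -> e n \notin S -> (4 <= n)%N ->
  n%:Z - 4 + `|value_at (S :\: strip_lines e n) - 4| <= - value_at S.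
Proof.
move=> st eS en n4; have := loose_strip_value_le st eS en n4.
have : value_at S <= value_at (S :\: strip_lines e n) - n%:Z.
  apply: (strip_take_all st) => -[|j] jn; first by rewrite orbC eS //; lia.
  by rewrite eS //; lia.
by lia.
Qed.

(** A line of [S] off the strip lies in the capture-free rest and claims nothing, so its value is
    minus that of the remaining position. *)
Lemma le_value_at_strip S e n (a : int) : e 1%N \in S ->
  capture_free (S :\: strip_lines e n) ->
  (forall m, (forall i, (0 < i <= n)%N -> e i != m) -> a <= - value_at (S :\ m)) ->
  (forall i, (0 < i <= n)%N -> e i \in S -> a <= move_value S (e i)) ->
  a <= value_at S.
Proof.
move=> e1 cf out ins; apply: le_value_at => [|m mS]; first by apply/set0Pn; exists (e 1%N).
case: (mem_strip_lines e n m) => [[i hi mi]|mX].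
  by rewrite mi; apply: ins; rewrite -?mi.
rewrite (capture_free_move _ cf) ?subsetDl //; last by rewrite inE mS andbT; apply/mem_strip_lines.
by apply: out => i hi; apply/eqP => ei; apply: mX; exists i.
Qed.

(** A move in the rest leaves the string to the opponent, an interior line gives the opponent the
    whole string, and [e 1] claims one box and shortens the string. Only the last can be good, and
    it is handled by induction down to a single isolated line. *)
Lemma string_value_ge S e b n : strip S e b n ->
  (forall i, (0 < i <= n)%N -> e i \in S) -> (2 <= n)%N ->
  capture_free (S :\: strip_lines e n) ->
  - value_at S <= n%:Z - 2 + `|value_at (S :\: strip_lines e n) - 2|.
Proof.
elim: n S e b => // n IHn S e b st eS n2 cf.
have e1 := eS 1%N isT; have e2 := eS 2%N n2.
rewrite lerNl; apply: (le_value_at_strip e1 cf) => [m out|i hi ei].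
  have stm : strip (S :\ m) e b n.+1 by apply: strip_sub st; rewrite subD1set.
  have := string_value_le_cost stm _ n2; set P := (forall i, _) => h.
  have /h : P by move=> i hi; rewrite !inE eS // out.
  by lia.
have [i1|ne] := eqVneq i 1%N; last first.
  have h : (n.+1%:Z - value_at (S :\: strip_lines e n.+1) <= move_value S (e i)).
    apply: (strip_move_interior st) => //; first by lia.
      by move=> j hj; apply: eS; lia.
    by rewrite eS ?orbT //; lia.
  by apply: le_trans h; lia.
rewrite {i hi ei}i1 /move_value (strip_claims st) // (strip_open st) e2 andbF /=.
have st1 := strip_remove_first st; have [n1|n1] := eqVneq n 1%N.
  subst n; rewrite (strip_isolated (i := 1) st1) /= ?setD11 ?(strip_remove st) //.
  suff -> : S :\ e 1%N :\ e 2%N = S :\: strip_lines e 2 by lia.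
  rewrite !setD_strip_lines; apply/setP => m; rewrite !inE.
  by case: mem_strip_lines => [[i]|_]; first by lia.
have /IHn := st1; rewrite -setD_strip_lines => h.
suff : forall i, (0 < i <= n)%N -> e i.+1 \in S :\ e 1 by move=> /h /(_ _ cf); lia.
by move=> i hi; rewrite (strip_remove st) ?eS; lia.
Qed.

(* Base case of [loose_strip_value_ge]: with three boxes, every move on the strip claims a box. *)
Lemma loose_strip3_value_ge S e b : strip S e b 3 -> e 1%N \in S -> e 2%N \in S -> e 3%N \notin S ->
  capture_free (S :\: strip_lines e 3) ->
  value_at (S :\: strip_lines e 3) - 3 <= value_at S.
Proof.
move=> st e1 e2 e3 cf; set X := S :\: _.
have XE : S :\ e 1%N :\ e 2%N = X.
  rewrite /X !setD_strip_lines; apply/setP => m; rewrite !inE.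
  case: mem_strip_lines => [[i]|_]; first by lia.
  by have [->|] := eqVneq m (e 3); rewrite ?(negPf e3) ?andbF.
apply: le_value_at => [|m mS]; first by apply/set0Pn; exists (e 1%N).
case: (mem_strip_lines e 3 m) => [[[|[|[|[|i]]]] // hi mi]|mX].
- rewrite mi /move_value (strip_claims st) //= e2 (strip_open st) /=.
  have st1 : strip (S :\ e 1%N) e b 3 by apply: strip_sub st; rewrite subD1set.
  by rewrite (strip_isolated (i := 2) st1) ?setD11 ?(strip_remove st) ?(negPf e3) ?XE //=; lia.
- rewrite mi /move_value (strip_claims st) //= e1 e3 /=.
  have st1 : strip (S :\ e 2%N) e b 3 by apply: strip_sub st; rewrite subD1set.
  rewrite (strip_isolated (i := 1) st1) ?setD11 ?(strip_open st1) ?(strip_remove st) //=.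
  have -> : S :\ e 2%N :\ e 1%N = X by rewrite -XE; apply/setP => z; rewrite !inE andbCA.
  by lia.
- by rewrite -mi mS in e3.
have {}mX : m \in X by rewrite inE mS andbT; apply/mem_strip_lines.
have XS : X \subset S by apply: subsetDl.
rewrite (capture_free_move XS cf mX).
have stm : strip (S :\ m) e b 3 by apply: strip_sub st; rewrite subD1set.
have := value_at_quiet mX (capture_free_claims (subxx _) cf mX).
suff : value_at (S :\ m) <= value_at (X :\ m) - 3 by lia.
rewrite /X -setDD1; apply: (strip_take_all stm) => j j3.
have ne i : (0 < i <= 3)%N -> e i \in S -> e i \in S :\ m.
  move=> hi ei; rewrite !inE ei andbT; apply: contraTneq mX => <-.
  by rewrite inE mem_strip.
by case: j j3 => [|[|[|j]]] // _; [rewrite orbC|..]; rewrite ne.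
Qed.

Lemma loose_strip_value_ge S e b n : strip S e b n ->
  (forall i, (0 < i < n)%N -> e i \in S) -> e n \notin S -> (4 <= n)%N ->
  capture_free (S :\: strip_lines e n) ->
  - value_at S <= n%:Z - 4 + `|value_at (S :\: strip_lines e n) - 4|.
Proof.
elim: n S e b => // n IHn S e b st eS en n4 cf.
have e1 : e 1%N \in S by apply: eS; lia.
have e2 : e 2%N \in S by apply: eS; lia.
rewrite lerNl; apply: (le_value_at_strip e1 cf) => [m out|i hi ei].
  have stm : strip (S :\ m) e b n.+1 by apply: strip_sub st; rewrite subD1set.
  have := loose_strip_value_le_cost stm _ _ n4; set P := (forall i, _) => h.
  have /h : P by move=> i hi; rewrite !inE eS // out //; lia.
  by rewrite !inE (negPf en) andbF => /(_ isT); lia.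
have lt : (i <= n)%N by rewrite leqNgt; apply: contraNN en => h; have <- : i = n.+1 by lia.
have [|mid] := boolP ((i == 1%N) || (i == n)); last first.
  have h : (n.+1%:Z - value_at (S :\: strip_lines e n.+1) <= move_value S (e i)).
    apply: (strip_move_interior st) => //; first by lia.
    by apply/orP; left; lia.
  by apply: le_trans h; lia.
case/orP => /eqP Ei; rewrite {lt hi}Ei in ei *.
  rewrite /move_value (strip_claims st) // (strip_open st) e2 andbF /=.
  have st1 := strip_remove_first st.
  have e1' k : (0 < k < n)%N -> e k.+1 \in S :\ e 1.
    by move=> hk; rewrite (strip_remove st) ?eS; lia.
  have en' : e n.+1 \notin S :\ e 1 by rewrite !inE (negPf en) andbF.
  have [n3|n3] := eqVneq n 3%N.
    subst n; rewrite setD_strip_lines in cf *.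
    by have := loose_strip3_value_ge st1 (e1' 1%N isT) (e1' 2%N isT) en' cf; lia.
  have /IHn := st1; rewrite -setD_strip_lines => /(_ e1' en' _ cf); lia.
(* The last undrawn line captures from the far end. What remains is again a loose strip, now ending
   at the drawn line [e n], next to the same rest. *)
have n1 : e n.-1 \in S by apply: eS; lia.
rewrite /move_value (strip_claims st) //; last by lia.
rewrite n1 en ltnSn /=.
have st1 : strip (S :\ e n) e b n.
  by apply: strip_trunc; [apply: strip_sub st; rewrite subD1set|rewrite setD11].
have e1' k : (0 < k < n)%N -> e k \in S :\ e n.
  by move=> hk; rewrite (strip_remove st) ?eS; lia.
have en' : e n \notin S :\ e n by rewrite setD11.
have XE : (S :\ e n) :\: strip_lines e n = S :\: strip_lines e n.+1.
  rewrite setDD1l; last by apply: mem_strip; lia.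
  apply/setP => m; rewrite !inE.
  case mS: (m \in S); rewrite ?andbF // !andbT; congr negb.
  apply/mem_strip_lines/mem_strip_lines => -[k hk mk]; exists k => //; first by lia.
  have : k != n.+1 by apply: contraNneq en => <-; rewrite -mk.
  by lia.
have [n3|n3] := eqVneq n 3%N.
  subst n; have := loose_strip3_value_ge st1 (e1' 1%N isT) (e1' 2%N isT) en'.
  by rewrite XE => /(_ cf); lia.
by have := IHn _ _ _ st1 e1' en' _; rewrite XE => /(_ _ cf); lia.
Qed.

End Positions.

(** * Chains and loops as components of a position *)

(* A component is encoded as (is it a loop, its length). *)
Definition cost (k : bool * nat) (x : int) : int :=
  let q : int := if k.1 then 4 else 2 in k.2%:Z - q + `|x - q|.

Section Pieces.
Variable g : game.
Implicit Types (S X L : {set line g}) (m d : line g) (x : box g).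
Implicit Types (e : nat -> line g) (b : nat -> box g) (n i j k : nat).

(** [chain_box] quantifies over all lines of the game and [chain_line] over all boxes, so the chain
    shares no incidence with the rest of the game. *)
Record chain_piece e b n : Prop := ChainPiece {
  chain_box : forall j m, (j < n)%N -> borders m (b j) = (m == e j) || (m == e j.+1);
  chain_line : forall i x, (i <= n)%N -> borders (e i) x -> exists2 j, (j < n)%N & x = b j;
  chain_lineI : forall i j, (i <= n)%N -> (j <= n)%N -> e i = e j -> i = j;
  chain_boxI : forall i j, (i < n)%N -> (j < n)%N -> b i = b j -> i = j }.

(** The enumerations are [n]-periodic on the natural numbers, so that cutting the loop at [e k] is a
    shift by [k]. *)
Record loop_piece e b n : Prop := LoopPiece {
  loop_box : forall j m, borders m (b j) = (m == e j) || (m == e j.+1);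
  loop_line : forall i x, borders (e i) x -> exists j, x = b j;
  loop_lineE : forall i j, (e i = e j) <-> (i = j %[mod n])%N;
  loop_boxE : forall i j, (b i = b j) <-> (i = j %[mod n])%N }.

Lemma chain_line_near e b n i x : chain_piece e b n -> (i <= n)%N -> borders (e i) x ->
  (i < n)%N /\ x = b i \/ (0 < i)%N /\ x = b i.-1.
Proof.
move=> cp hi ex; have [j jn xj] := chain_line cp hi ex.
move: ex; rewrite xj (chain_box cp) // => /orP[] /eqP /(chain_lineI cp) ij.
  by left; rewrite ij //; lia.
by right; rewrite ij //; lia.
Qed.

Lemma strip_right S e b n k : chain_piece e b n -> (k <= n)%N -> e k \notin S ->
  strip S (fun i => e (k + i)%N) (fun j => b (k + j)%N) (n - k).
Proof.
move=> cp kn ek; split=> [|j m jn mS|i x hi eS ex|i j hi hj h|i j hi hj h].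
- by rewrite addn0.
- by rewrite addnS (chain_box cp) //; lia.
- have := chain_line_near cp _ ex.
  have -> : (k + i.-1 = (k + i).-1)%N by lia.
  by case=> [|[h ->]|[h ->]]; [lia|right; split=> //; lia|left].
- by have := chain_lineI cp _ _ h; lia.
- by have := chain_boxI cp _ _ h; lia.
Qed.

Lemma strip_left S e b n k : chain_piece e b n -> (k <= n)%N -> e k \notin S ->
  strip S (fun i => e (k - i)%N) (fun j => b (k - j.+1)%N) k.
Proof.
move=> cp kn ek; split=> [|j m jn mS|i x hi eS ex|i j hi hj h|i j hi hj h].
- by rewrite subn0.
- have -> : (k - j = (k - j.+1).+1)%N by lia.
  by rewrite (chain_box cp) 1?orbC //; lia.
- have := chain_line_near cp _ ex.
  have -> : (k - i.-1.+1 = k - i)%N by lia.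
  have -> : (k - i.+1 = (k - i).-1)%N by lia.
  by case=> [|[h ->]|[h ->]]; [lia|left|right; split=> //; lia].
- by have := chain_lineI cp _ _ h; lia.
- by have := chain_boxI cp _ _ h; lia.
Qed.

Definition first_lines e n : {set line g} := [set e i | i : 'I_n].

Lemma mem_first_lines e n m :
  reflect (exists2 i, (i < n)%N & m = e i) (m \in first_lines e n).
Proof.
apply: (iffP imsetP) => [[i _ ->]|[i hi ->]]; first by exists i.
by exists (Ordinal hi).
Qed.

Lemma first_lines_split e n k : (k <= n)%N ->
  first_lines e n.+1 = e k |: (strip_lines (fun i => e (k - i)%N) k :|:
                               strip_lines (fun i => e (k + i)%N) (n - k)).
Proof.
move=> kn; apply/setP => m; rewrite !in_setU !inE.
apply/mem_first_lines/or3P => [[i hi ->]|].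
  case: (ltngtP i k) => ik; last by apply: Or31; rewrite ik.
    by apply: Or32; apply/mem_strip_lines; exists (k - i)%N; [lia|congr e; lia].
  by apply: Or33; apply/mem_strip_lines; exists (i - k)%N; [lia|congr e; lia].
case=> [/eqP->|/mem_strip_lines[i hi ->]|/mem_strip_lines[i hi ->]].
- by exists k.
- by exists (k - i)%N => //; lia.
- by exists (k + i)%N => //; lia.
Qed.

(** As n >= 3, one of the two strings next to [e k] has at least two boxes. The opponent takes the
    other one whole and then plays this one as a string, with the same total as after an opening at
    an end. *)
Lemma chain_move_ge S e b n k : chain_piece e b n -> first_lines e n.+1 \subset S ->
  (3 <= n)%N -> (k <= n)%N ->
  cost (false, n) (value_at (S :\: first_lines e n.+1)) <= - value_at (S :\ e k).
Proof.
move=> cp /subsetP LS n3 kn; rewrite /cost /=.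
have ek : e k \notin S :\ e k by rewrite setD11.
have eS i : (i <= n)%N -> i != k -> e i \in S :\ e k.
  move=> hi ik; rewrite !inE LS ?andbT; last by apply/mem_first_lines; exists i.
  by apply: contraNneq ik => /(chain_lineI cp) ->.
have sl := strip_left cp kn ek; have sr := strip_right cp kn ek.
set A := strip_lines (fun i => e (k - i)%N) k in sl *.
have Al : value_at (S :\ e k) <= value_at ((S :\ e k) :\: A) - k%:Z.
  by apply: (strip_take_all sl) => j jk; rewrite orbC eS //; lia.
set B := strip_lines (fun i => e (k + i)%N) (n - k) in sr *.
have Br : value_at (S :\ e k) <= value_at ((S :\ e k) :\: B) - (n - k)%N%:Z.
  by apply: (strip_take_all sr) => j jk; rewrite orbC eS //; lia.
have E : S :\ e k :\: A :\: B = S :\: first_lines e n.+1.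
  by rewrite (first_lines_split _ kn) !setDDl setUA.
have E' : S :\ e k :\: B :\: A = S :\: first_lines e n.+1.
  by rewrite -E !setDDl (setUC A).
have [h|h] := leqP 2 (n - k).
  have sr' : strip (S :\ e k :\: A) (fun i => e (k + i)%N) (fun j => b (k + j)%N) (n - k).
    by apply: strip_sub sr; rewrite subsetDl.
  have := string_value_le_cost sr' _ h; rewrite E => H.
  suff /H : forall i, (0 < i <= n - k)%N -> e (k + i)%N \in S :\ e k :\: A by lia.
  move=> i hi; rewrite inE eS ?andbT; try lia.
  apply/mem_strip_lines => -[j hj /(chain_lineI cp)]; lia.
have sl' : strip (S :\ e k :\: B) (fun i => e (k - i)%N) (fun j => b (k - j.+1)%N) k.
  by apply: strip_sub sl; rewrite subsetDl.
have k2 : (2 <= k)%N by lia.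
have := string_value_le_cost sl' _ k2; rewrite E' => H.
suff /H : forall i, (0 < i <= k)%N -> e (k - i)%N \in S :\ e k :\: B by lia.
move=> i hi; rewrite inE eS ?andbT; try lia.
apply/mem_strip_lines => -[j hj /(chain_lineI cp)]; lia.
Qed.

(** The end line leaves one string with all the boxes, from which the opponent gets no more than its
    cost. *)
Lemma chain_move_le S e b n : chain_piece e b n -> first_lines e n.+1 \subset S ->
  (3 <= n)%N -> capture_free (S :\: first_lines e n.+1) ->
  - value_at (S :\ e 0) <= cost (false, n) (value_at (S :\: first_lines e n.+1)).
Proof.
move=> cp /subsetP LS n3 cf; rewrite /cost /=.
have ek : e 0 \notin S :\ e 0 by rewrite setD11.
have sr := strip_right cp (leq0n _) ek; rewrite subn0 in sr.
have E : S :\ e 0 :\: strip_lines e n = S :\: first_lines e n.+1.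
  rewrite (first_lines_split _ (leq0n _)) subn0 setDDl setUA; congr (_ :\: (_ :|: _)).
  apply/setP => m; rewrite !in_setU; case: mem_strip_lines => [[i]|_]; first by lia.
  by rewrite orbF.
rewrite -E in cf *; apply: (string_value_ge sr) => // [i hi|]; last by lia.
rewrite !inE LS ?andbT; last by apply/mem_first_lines; exists i => //; lia.
by apply/eqP => /(chain_lineI cp); lia.
Qed.

(** Both ends of this strip are the same drawn line, as [e (k + n) = e k]; this is why [strip] asks
    for injectivity of the lines only from index 1 on. *)
Lemma loop_strip S e b n k : (0 < n)%N -> loop_piece e b n -> e k \notin S ->
  strip S (fun i => e (k + i)%N) (fun j => b (k + j)%N) n.
Proof.
move=> n0 lp ek.
have inj i j : (i < n)%N -> (j < n)%N -> (k + i = k + j %[mod n])%N -> i = j.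
  by move=> hi hj /eqP; rewrite eqn_modDl !modn_small // => /eqP.
split=> [|j m jn mS|i x hi eS ex|i j hi hj /(loop_lineE lp) h|i j hi hj /(loop_boxE lp) h].
- by rewrite addn0.
- by rewrite addnS (loop_box lp).
- have [j xj] := loop_line lp ex; move: ex.
  rewrite xj (loop_box lp) => /orP[] /eqP /(loop_lineE lp) ij.
    have [|ni] := ltnP i n; last first.
      have E : i = n by lia.
      move: eS; rewrite E (_ : e (k + n)%N = e k) ?(negPf ek) //.
      by apply/(loop_lineE lp); rewrite modnDr.
    by move=> lt; right; split=> //; apply/(loop_boxE lp).
  left; apply/(loop_boxE lp)/eqP; rewrite -(eqn_modDr 1) !addn1 -ij; apply/eqP; congr modn; lia.
- case: i j hi hj h => [|i] [|j] //= hi hj h; congr _.+1; apply: inj => //.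
  by apply/eqP; rewrite -(eqn_modDr 1) !addn1 -!addnS; apply/eqP.
- exact: inj.
Qed.

Lemma loop_lines_rot e b n k : (0 < n)%N -> loop_piece e b n ->
  strip_lines (fun i => e (k + i)%N) n = first_lines e n.
Proof.
move=> n0 lp; apply/setP => m; apply/mem_strip_lines/mem_first_lines => [[i hi ->]|[i hi ->]].
  exists ((k + i) %% n)%N; first by rewrite ltn_mod.
  by apply/(loop_lineE lp); rewrite modn_mod.
(* The index sought is i - k modulo n; adding [n * k] avoids truncated subtraction. The residue 0 is
   replaced by n, because the lines of a strip are numbered from 1 to n. *)
have [] := ltnP 0 ((i + n * k - k) %% n) => h.
  exists ((i + n * k - k) %% n)%N; first by rewrite h ltnW // ltn_mod.
  by apply/(loop_lineE lp); rewrite modnDmr subnKC; [rewrite addnC mulnC modnMDl|nia].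
exists n; first by rewrite n0 leqnn.
apply/(loop_lineE lp); rewrite modnDr.
have : (k + (i + n * k - k) %% n)%N = (k + 0)%N %[mod n] by congr modn; lia.
rewrite modnDmr addn0 subnKC; last by nia.
by rewrite addnC mulnC modnMDl => ->.
Qed.

(** All lines of a loop are alike, so both bounds hold for every opening, unlike for chains. *)
Lemma loop_move S e b n k : loop_piece e b n -> first_lines e n \subset S ->
  (4 <= n)%N -> 
  cost (true, n) (value_at (S :\: first_lines e n)) <= - value_at (S :\ e k) /\
  (capture_free (S :\: first_lines e n) ->
   - value_at (S :\ e k) <= cost (true, n) (value_at (S :\: first_lines e n))).
Proof.
move=> lp /subsetP LS n4; rewrite /cost /=; have n0 : (0 < n)%N by lia.
have ek : e k \notin S :\ e k by rewrite setD11.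
have st := loop_strip n0 lp ek.
have E : S :\ e k :\: strip_lines (fun i => e (k + i)%N) n = S :\: first_lines e n.
  rewrite (loop_lines_rot _ n0 lp) setDD1l // -(loop_lines_rot k n0 lp).
  apply/mem_strip_lines; exists n; first by rewrite n0 leqnn.
  by apply/(loop_lineE lp); rewrite modnDr.
have en : e (k + n)%N \notin S :\ e k.
  by rewrite (_ : e (k + n)%N = e k) //; apply/(loop_lineE lp); rewrite modnDr.
have eS i : (0 < i < n)%N -> e (k + i)%N \in S :\ e k.
  move=> hi; rewrite !inE LS ?andbT.
    apply/eqP => /(loop_lineE lp)/eqP; rewrite -{2}[k]addn0 eqn_modDl mod0n modn_small; lia.
  by rewrite -(loop_lines_rot k n0 lp); apply/mem_strip_lines; exists i => //; lia.
rewrite -E; split.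
  exact: (loose_strip_value_le_cost st).
exact: (loose_strip_value_ge st).
Qed.

End Pieces.

Definition piece (g : game) (L : {set line g}) (k : bool * nat) : Prop :=
  if k.1 then exists e b, [/\ @loop_piece g e b k.2, L = first_lines e k.2 & (4 <= k.2)%N]
  else exists e b, [/\ @chain_piece g e b k.2, L = first_lines e k.2.+1 & (3 <= k.2)%N].

Section PieceMoves.
Variable g : game.
Implicit Types (S L : {set line g}) (k : bool * nat).

Lemma piece_capture_free L k : piece L k -> capture_free L.
Proof.
case: k => -[] n; rewrite /piece /= => -[e [b [p -> hn]]] m x /mem_first_lines[i hi ->] ex.
  have [j xj] := loop_line p ex; move: ex; rewrite xj (loop_box p).
  have ne : e j != e j.+1.
    apply/eqP => /(loop_lineE p)/eqP; rewrite -addn1 -{1}[j]addn0 eqn_modDl mod0n modn_small; lia.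
  have eL (l : nat) : e l \in first_lines e n.
    apply/mem_first_lines; exists (l %% n)%N; first by rewrite ltn_mod; lia.
    by apply/(loop_lineE p); rewrite modn_mod.
  case/orP => /eqP ->; [exists (e j.+1)|exists (e j)]; split=> //.
  + by rewrite eq_sym.
  + by rewrite (loop_box p) eqxx orbT.
  + by rewrite (loop_box p) eqxx.
have [j jn xj] := chain_line p hi ex; move: ex; rewrite xj (chain_box p) //.
have ne : e j != e j.+1 by apply/eqP => /(chain_lineI p); lia.
case/orP => /eqP ->; [exists (e j.+1)|exists (e j)]; split=> //.
+ by apply/mem_first_lines; exists j.+1.
+ by rewrite eq_sym.
+ by rewrite (chain_box p) // eqxx orbT.
+ by apply/mem_first_lines; exists j => //; lia.
+ by rewrite (chain_box p) // eqxx.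
Qed.

Lemma piece_move_ge S L k m : piece L k -> L \subset S -> capture_free S -> m \in L ->
  cost k (value_at (S :\: L)) <= move_value S m.
Proof.
case: k => -[] n; rewrite /piece /= => -[e [b [p -> hn]]] LS cf mL;
  rewrite (capture_free_move (subxx _) cf (subsetP LS _ mL)); case/mem_first_lines: mL => i hi ->.
  by have [] := loop_move i p LS hn.
exact: (chain_move_ge p LS).
Qed.

Lemma piece_move_le S L k : piece L k -> L \subset S -> capture_free S ->
  capture_free (S :\: L) ->
  exists2 m, m \in L & move_value S m <= cost k (value_at (S :\: L)).
Proof.
case: k => -[] n; rewrite /piece /= => -[e [b [p -> hn]]] LS cf cf';
  [have mL : e 0%N \in first_lines e n | have mL : e 0%N \in first_lines e n.+1];
  try by apply/mem_first_lines; exists 0%N => //; lia.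
  exists (e 0%N) => //; rewrite (capture_free_move (subxx _) cf (subsetP LS _ mL)).
  by have [_ ->] := loop_move 0%N p LS hn.
exists (e 0%N) => //; rewrite (capture_free_move (subxx _) cf (subsetP LS _ mL)).
exact: (chain_move_le p LS).
Qed.

End PieceMoves.

(** * The recursion on multisets of components *)

Fixpoint endgame_value_rec (n : nat) (ks : seq (bool * nat)) : int :=
  if n is n'.+1 then seq_min [seq cost k (endgame_value_rec n' (rem k ks)) | k <- ks]
  else 0.

Definition endgame_value ks := endgame_value_rec (size ks) ks.

Lemma eq_mem_seq_min (s t : seq int) : s =i t -> seq_min s = seq_min t.
Proof.
move=> st; case: s st => [|x s] st.
  by case: t st => [|y t] // st; have := st y; rewrite !inE eqxx.
have [//|sm sl] := @seq_minP (x :: s).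
have [|tm tl] := @seq_minP t; first by apply: contraTneq (mem_head x s) => t0; rewrite st t0.
by apply/eqP; rewrite eq_le tl -?st // sl // st.
Qed.

Lemma perm_rem (T : eqType) (x : T) (s t : seq T) :
  perm_eq s t -> perm_eq (rem x s) (rem x t).
Proof.
move=> st; have [xs|xs] := boolP (x \in s); last first.
  by rewrite !rem_id // -(perm_mem st).
rewrite -(perm_cons x) -(permPl (perm_to_rem xs)) (permPl st).
by apply: perm_to_rem; rewrite -(perm_mem st).
Qed.

Lemma endgame_value_perm ks ks' : perm_eq ks ks' -> endgame_value ks = endgame_value ks'.
Proof.
rewrite /endgame_value => pk; rewrite -(perm_size pk).
move: (size ks) => n; elim: n ks ks' pk => //= n IHn ks ks' pk; apply: eq_mem_seq_min => x.
suff -> : [seq cost k (endgame_value_rec n (rem k ks)) | k <- ks] =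
          [seq cost k (endgame_value_rec n (rem k ks')) | k <- ks].
  exact: (perm_mem (perm_map _ pk)).
by apply: eq_map => k; congr cost; apply: IHn; apply: perm_rem.
Qed.

Lemma endgame_valueE ks : ks != [::] ->
  endgame_value ks = seq_min [seq cost k (endgame_value (rem k ks)) | k <- ks].
Proof.
case: ks => // k0 ks _; congr seq_min; apply/eq_in_map => k kks.
by rewrite /endgame_value size_rem.
Qed.

Lemma endgame_value_le ks k : k \in ks -> endgame_value ks <= cost k (endgame_value (rem k ks)).
Proof.
move=> kks; have ks0 : ks != [::] by apply: contraTneq kks => ->.
rewrite endgame_valueE //; set s := map _ _; have [|_ ->//] := @seq_minP s.
  by rewrite -size_eq0 size_map size_eq0.
by apply/mapP; exists k.
Qed.

Lemma endgame_value_attained ks : ks != [::] ->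
  exists2 k, k \in ks & endgame_value ks = cost k (endgame_value (rem k ks)).
Proof.
move=> ks0; rewrite endgame_valueE //; set s := map _ _.
have [|/mapP[k kks ->] _] := @seq_minP s; last by exists k.
by rewrite -size_eq0 size_map size_eq0.
Qed.

(** * Positions partitioned into components *)

Definition cover_count (T : finType) (m : T) (ps : seq ({set T} * (bool * nat))) : nat :=
  count (fun p : {set T} * (bool * nat) => m \in p.1) ps.

Section Decomposition.
Variable g : game.
Implicit Types (S T L : {set line g}) (ps qs : seq ({set line g} * (bool * nat))).

(** The counting hypothesis says that the pieces partition [S], in a form that survives the removal
    of a piece. Every move lies in one piece and costs at least the [cost] of that piece, and every
    piece has a line attaining it, so the minimum over moves becomes a minimum over pieces. *)
Lemma value_pieces ps S : (forall p, p \in ps -> piece p.1 p.2) ->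
  (forall m : line g, cover_count m ps = (m \in S) :> nat) ->
  value_at S = endgame_value [seq p.2 | p <- ps].
Proof.
have sub qs T p : (forall m : line g, cover_count m qs = (m \in T) :> nat) -> p \in qs ->
    p.1 \subset T.
  move=> hT pq; apply/subsetP => m mp; apply/negPn/negP => mT.
  have := hT m; rewrite /cover_count (negPf mT) => /eqP.
  rewrite -leqn0 leqNgt -has_count => /hasPn/(_ _ pq).
  by rewrite mp.
have cfree qs T : (forall p, p \in qs -> piece p.1 p.2) ->
    (forall m : line g, cover_count m qs = (m \in T) :> nat) -> capture_free T.
  move=> hp hT m x mT mx.
  have : has (fun p : {set line g} * (bool * nat) => m \in p.1) qs.
    by rewrite has_count -/(cover_count m qs) hT mT.
  case/hasP => p pq mp; have [m' [m'p ne m'x]] := piece_capture_free (hp _ pq) mp mx.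
  by exists m'; split=> //; apply: (subsetP (sub _ _ _ hT pq)).
have rem_count qs T p : (forall m : line g, cover_count m qs = (m \in T) :> nat) -> p \in qs ->
    forall m : line g, cover_count m (rem p qs) = (m \in T :\: p.1) :> nat.
  move=> hT pq m; rewrite /cover_count count_rem pq -/(cover_count m qs) hT inE.
  have := subsetP (sub _ _ _ hT pq) m.
  by case: (m \in p.1) => //= [->//|_]; rewrite subn0.
elim: {ps}(size ps) {-2}ps (erefl (size ps)) S => [|n IHn] ps sz S hp hS.
  case: ps sz hp hS => // _ _ hS; rewrite (_ : S = set0) ?value_at0 //.
  by apply/setP => m; rewrite inE; have := hS m; case: (m \in S).
have cf := cfree _ _ hp hS.
have IH p : p \in ps -> value_at (S :\: p.1) = endgame_value (rem p.2 [seq p.2 | p <- ps]).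
  move=> pps; rewrite (IHn (rem p ps)) ?size_rem ?sz //.
  - apply: endgame_value_perm; have /(perm_map snd) := perm_to_rem pps.
    by move=> /(perm_rem p.2) /=; rewrite eqxx perm_sym.
  - by move=> q /mem_rem/hp.
  - exact: rem_count.
have hcf p : p \in ps -> capture_free (S :\: p.1).
  by move=> pps; apply: cfree (rem_count _ _ _ hS pps) => q /mem_rem/hp.
apply/eqP; rewrite eq_le; apply/andP; split.
  have [|k /mapP[p pps ->] ->] := @endgame_value_attained [seq p.2 | p <- ps].
    by rewrite -size_eq0 size_map sz.
  have [m mp le] := piece_move_le (hp _ pps) (sub _ _ _ hS pps) cf (hcf _ pps).
  by rewrite -IH //; apply: le_trans le; apply/value_at_le/(subsetP (sub _ _ _ hS pps)).
apply: le_value_at => [|m mS].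
  case: ps sz hp hS {IHn cf IH hcf} => // p ps _ hp hS.
  have pS := sub _ _ _ hS (mem_head p ps).
  have [|m mp _] := piece_move_le (hp p (mem_head _ _)) pS (cfree _ _ hp hS).
    by apply: cfree (rem_count _ _ _ hS (mem_head _ _)) => q /mem_rem/hp.
  by apply/set0Pn; exists m; apply: (subsetP pS).
have : has (fun p : {set line g} * (bool * nat) => m \in p.1) ps.
  by rewrite has_count -/(cover_count m ps) hS mS.
case/hasP => p pps mp.
apply: le_trans (piece_move_ge (hp _ pps) (sub _ _ _ hS pps) cf mp).
by rewrite IH //; apply/endgame_value_le/map_f.
Qed.

End Decomposition.

(** Being a piece only depends on incidences near it, so it is preserved by injections whose image
    is closed under incidence, such as the two inclusions into a disjoint union. *)
Lemma piece_embed (G H : game) (f : line G -> line H) (h : box G -> box H)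
    (L : {set line G}) k :
  injective f -> injective h ->
  (forall m x, borders (f m) (h x) = borders m x) ->
  (forall m x, borders m (h x) -> exists m', m = f m') ->
  (forall m x, borders (f m) x -> exists x', x = h x') ->
  piece L k -> piece (f @: L) k.
Proof.
move=> fI hI fh fbox hline.
have imf e n : f @: first_lines e n = first_lines (f \o e) n by rewrite -imset_comp.
have hbox b m x y : (forall m', borders m' b = (m' == x) || (m' == y)) ->
    borders m (h b) = (m == f x) || (m == f y).
  move=> hb; apply/idP/orP => [mb|].
    have [m' mE] := fbox _ _ mb; move: mb; rewrite mE fh hb.
    by case/orP => /eqP ->; [left|right].
  by case=> /eqP ->; rewrite fh hb eqxx ?orbT.
case: k => -[] n; rewrite /piece /= => -[e [b [p -> hn]]];
  exists (f \o e), (h \o b); split; rewrite ?imf //.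
  split=> [j m|i x /= ex|i j|i j].
  - by apply: hbox => m'; apply: (loop_box p).
  - have [x' xE] := hline _ _ ex; rewrite xE fh in ex *.
    by have [j ->] := loop_line p ex; exists j.
  - by rewrite -(loop_lineE p); split=> [/fI|/= ->].
  - by rewrite -(loop_boxE p); split=> [/hI|/= ->].
split=> [j m jn|i x hi /= ex|i j hi hj|i j hi hj].
- by apply: hbox => m'; apply: (chain_box p).
- have [x' xE] := hline _ _ ex; rewrite xE fh in ex *.
  by have [j jn ->] := chain_line p hi ex; exists j.
- by move=> /fI; apply: (chain_lineI p).
- by move=> /hI; apply: (chain_boxI p).
Qed.

Definition piece_game (k : bool * nat) : game := (if k.1 then loop else chain) k.2.

Definition piece_ok (k : bool * nat) := ((if k.1 then 4 else 3) <= k.2)%N.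

Lemma piece_whole k : piece_ok k -> piece [set: line (piece_game k)] k.
Proof.
case: k => -[] [|n] //=; rewrite /piece_ok /piece_game /piece /= => hn.
  (* In [loop_borders], line i borders boxes i and i + 1, so the box between lines j and j + 1 has
     number j + 1. *)
  exists (fun i => inord (i %% n.+1)), (fun j => inord (j.+1 %% n.+1)).
  have mK i : (inord (i %% n.+1) : 'I_n.+1) = (i %% n.+1)%N :> nat by rewrite inordK // ltn_mod.
  have addS (i j : nat) : (i.+1 == j.+1 %[mod n.+1])%N = (i == j %[mod n.+1])%N.
    by rewrite -[i.+1]addn1 -[j.+1]addn1 eqn_modDr.
  have mE i j : (inord (i %% n.+1) = inord (j %% n.+1) :> 'I_n.+1) <-> (i = j %[mod n.+1])%N.
    by split=> [/(congr1 val)|->//] /=; rewrite !mK.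
  split=> //; last first.
    apply/setP => m; rewrite inE; symmetry; apply/imsetP; exists m => //.
    by rewrite modn_small // inord_val.
  split=> [j m|i x _|i j|i j].
  - rewrite /= /loop_borders -!val_eqE /= !mK orbC [_ == val m]eq_sym; congr orb.
    by rewrite addS eq_sym (modn_small (ltn_ord m)).
  (* The loop has length n + 1, so x + n stands for x - 1 and undoes the shift of the boxes. *)
  - exists (x + n)%N; apply: val_inj; rewrite /= mK -addnS modnDr modn_small //.
  - exact: mE.
  - by rewrite mE; split=> /eqP; [rewrite addS|rewrite -addS] => /eqP.
exists (fun i => inord i), (fun j => inord j); split=> //; last first.
  apply/setP => m; rewrite inE; symmetry; apply/imsetP; exists m => //.
  by rewrite inord_val.
split=> [j m jn|i x hi _|i j hi hj|i j hi hj].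
- by rewrite /= /chain_borders -!val_eqE /= !inordK //; lia.
- by exists (nat_of_ord x); [apply: ltn_ord|rewrite inord_val].
- by move=> /(congr1 val) /=; rewrite !inordK.
- by move=> /(congr1 val) /=; rewrite !inordK.
Qed.

Lemma value_piece_games ks : all piece_ok ks ->
  value (foldr union empty_game (map piece_game ks)) = endgame_value ks.
Proof.
set U := foldr _ _; move=> ok.
suff [ps [hks hp hc]] : exists ps : seq ({set line (U (map piece_game ks))} * (bool * nat)),
    [/\ map snd ps = ks, forall p, p \in ps -> piece p.1 p.2 &
        forall m, cover_count m ps = 1%N].
  by rewrite -[in RHS]hks /value; apply: value_pieces => // m; rewrite inE hc.
elim: ks ok => [_|k ks IHks /= /andP[kok /IHks[ps [hks hp hc]]]].
  by exists [::]; split=> // -[].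
set H := U (map piece_game ks) in ps hp hc hks *; pose G := piece_game k.
pose lift (q : {set line H} * (bool * nat)) : {set line (union G H)} * (bool * nat) :=
  (inr @: q.1, q.2).
pose new : {set line (union G H)} := inl @: [set: line G].
exists ((new, k) :: map lift ps); split.
- by rewrite /= -map_comp -[in RHS]hks; congr cons; apply: eq_map.
- move=> p; rewrite inE => /predU1P[-> /=|/mapP[q qps -> /=]].
    apply: (@piece_embed _ (union G H) inl inl) (piece_whole kok) => //.
    + exact: inl_inj.
    + exact: inl_inj.
    + by case=> // m x _; exists m.
    + by move=> m [] // x _; exists x.
  apply: (@piece_embed _ (union G H) inr inr) (hp _ qps) => //.
  + exact: inr_inj.
  + exact: inr_inj.
  + by case=> // m x _; exists m.
  + by move=> m [] // x _; exists x.
- case=> m; rewrite /cover_count /= count_map.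
    rewrite imset_f ?inE // (eq_count (a2 := pred0)) ?count_pred0 // => p /=.
    by apply/imsetP => -[].
  have -> : (inr m \in new) = false by apply/imsetP => -[].
  by rewrite -[RHS](hc m); apply: eq_count => p /=; rewrite mem_imset //; apply: inr_inj.
Qed.

(** * Values from the recursion *)

Local Notation W := endgame_value.
Implicit Types (k : bool * nat) (ks H : seq (bool * nat)).

(** The summand of [fcv]. It is also [cost k x - x] as soon as x is at least 2 for a chain, or 4 for
    a loop. *)
Definition weight k : int := k.2%:Z - (if k.1 then 8 else 4).

Definition total_weight ks : int := \sum_(k <- ks) weight k.

Lemma not_dvd2z (x : int) : ~~ (2 %| x)%Z -> exists q : int, x = q * 2 + 1.
Proof. by exists (x %/ 2)%Z; lia. Qed.

Lemma total_weight_cons k ks : total_weight (k :: ks) = weight k + total_weight ks.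
Proof. exact: big_cons. Qed.

Lemma total_weight_rem k ks : k \in ks -> total_weight (rem k ks) = total_weight ks - weight k.
Proof. by move=> kks; rewrite {2}/total_weight (big_rem _ kks) /= addrC addrK. Qed.

(** With y = x - q, the difference between [cost k x] and [weight k + x] is |y| - y, which is
    even. *)
Lemma endgame_value_parity ks : exists z : int, W ks = total_weight ks + z * 2.
Proof.
elim: {ks}(size ks) {-2}ks (erefl (size ks)) => [|n IHn] ks sz.
  by case: ks sz => // _; exists 0; rewrite /total_weight big_nil.
have [|k kks ->] := @endgame_value_attained ks; first by rewrite -size_eq0 sz.
have [|z ->] := IHn (rem k ks); first by rewrite size_rem // sz.
rewrite (total_weight_rem kks); set t := total_weight ks.
case: k kks => -[] c _; rewrite /cost /weight /=.
  case: (lerP 0 (t - (c%:Z - 8) + z * 2 - 4)) => h.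
    by exists z; lia.
  by exists (c%:Z - 8 + 4 - t - z); lia.
case: (lerP 0 (t - (c%:Z - 4) + z * 2 - 2)) => h.
  by exists z; lia.
by exists (c%:Z - 4 + 2 - t - z); lia.
Qed.

(** Since |y| - y >= 0, each opening adds at least its weight. The 4 comes from the last component,
    which costs its full length: its weight plus 4 for a chain, plus 8 for a loop. *)
Lemma endgame_value_lower ks : ks != [::] -> total_weight ks + 4 <= W ks.
Proof.
elim: {ks}(size ks) {-2}ks (erefl (size ks)) => [|n IHn] ks sz ks0.
  by move: ks0; rewrite -size_eq0 sz.
have [k kks ->] := @endgame_value_attained ks ks0.
have := total_weight_rem kks; have [r0|r0] := eqVneq (rem k ks) [::].
  rewrite r0 {1}/total_weight big_nil /W /= /cost /weight.
  by case: k {kks r0} => -[] c /=; lia.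
have := IHn (rem k ks) _ r0; rewrite size_rem // sz => /(_ erefl).
by rewrite /cost /weight; case: k {kks r0} => -[] c /=; lia.
Qed.

(** * Endgames without 3-chains *)

Definition long_pieces ks :=
  all (fun k => (4 <= k.2)%N && (k.1 ==> ~~ odd k.2)) ks.

(** These endgames have terminal bonus 4, so [total_weight ks + 4] is their controlled value. *)
Definition long_endgame ks := long_pieces ks && has (fun k => ~~ k.1) ks.

Lemma long_pieces_rem k ks : long_pieces ks -> long_pieces (rem k ks).
Proof. exact: all_rem. Qed.

Lemma long_endgame_rem_loop n ks : long_endgame ks -> long_endgame (rem (true, n) ks).
Proof.
case/andP => h /hasP[k kks k1]; rewrite /long_endgame long_pieces_rem //=.
apply/hasP; exists k => //; apply: rem_mem => //.
by apply: contraNneq k1 => ->.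
Qed.

Lemma endgame_value_ge0 ks : long_pieces ks -> 0 <= W ks.
Proof.
elim: {ks}(size ks) {-2}ks (erefl (size ks)) => [|n IHn] ks sz lks.
  by case: ks sz lks.
have [|k kks ->] := @endgame_value_attained ks; first by rewrite -size_eq0 sz.
by have := allP lks _ kks; case: k kks => -[] c kks; rewrite /cost /=; lia.
Qed.

Lemma total_weight_ge0 ks : all (fun k => 0 <= weight k) ks -> 0 <= total_weight ks.
Proof. by move=> /allP h; rewrite /total_weight big_seq sumr_ge0. Qed.

Lemma long_piece_weight_ge0 k ks : long_pieces ks -> k \in ks ->
  k != (true, 4%N) -> k != (true, 6%N) -> 0 <= weight k.
Proof.
move=> lks /(allP lks); rewrite /weight; case: k => -[] c /=; rewrite -?pair_eqE /=; lia.
Qed.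

Lemma rem_loop_neq0 n ks : long_endgame ks -> rem (true, n) ks != [::].
Proof.
move=> /(long_endgame_rem_loop n)/andP[_ /hasP[k kks _]].
by apply: contraTneq kks => ->.
Qed.

Lemma long_endgame_neq0 ks : long_endgame ks -> ks != [::].
Proof. by case: ks. Qed.

(* A cheapest loop goes first; once no loops are left, every chain may be opened. *)
Lemma long_endgame_value ks : long_endgame ks -> 2 <= total_weight ks + 4 ->
  W ks = total_weight ks + 4.
Proof.
elim: {ks}(size ks) {-2}ks (erefl (size ks)) => [|n IHn] ks sz lks cv2.
  by case: ks sz lks cv2.
apply/eqP; rewrite eq_le (endgame_value_lower (long_endgame_neq0 lks)) andbT.
have [lp _] := andP lks.
(* The bound on c says that the rest has controlled value at least 4, so the absolute value in the
   cost of the loop opens without loss. For 6-loops it is exactly the hypothesis that the controlled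
   value is at least 2. *)
have step c : (true, c) \in ks -> c%:Z <= total_weight ks + 8 -> W ks <= total_weight ks + 4.
  move=> cks h; apply: le_trans (endgame_value_le cks) _.
  rewrite IHn ?total_weight_rem ?long_endgame_rem_loop //; first last.
  - by rewrite /weight /=; lia.
  - by rewrite size_rem // sz.
  by rewrite /cost /weight /=; lia.
have [c4|no4] := boolP ((true, 4%N) \in ks); first by apply: step c4 _; lia.
have [c6|no6] := boolP ((true, 6%N) \in ks); first by apply: step c6 _; lia.
have w0 k : k \in ks -> 0 <= weight k.
  move=> kks; apply: (long_piece_weight_ge0 lp kks).
    by apply: contraNneq no4 => <-.
  by apply: contraNneq no6 => <-.
have tw0 k : k \in ks -> 0 <= total_weight (rem k ks).
  by move=> kks; apply/total_weight_ge0/all_rem/allP.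
have [/hasP[[l c] cks /= lc]|noloop] := boolP (has (fun k => k.1) ks).
  case: l lc cks => // _ cks; apply: (step c) => //.
  by have := tw0 _ cks; rewrite total_weight_rem // /weight /=; lia.
have chain k : k \in ks -> k = (false, k.2).
  by move=> kks; have := hasPn noloop _ kks; case: k {kks} => -[].
have [c kks] : exists c, (false, c) \in ks.
  have /hasP[k kks _] : has predT ks by rewrite has_predT sz.
  by exists k.2; rewrite -chain.
apply: le_trans (endgame_value_le kks) _; have tE := total_weight_rem kks.
have [r0|r0] := eqVneq (rem (false, c) ks) [::].
  by move: tE; rewrite r0 {1}/total_weight big_nil /W /= /cost /weight /=; lia.
have lr : long_endgame (rem (false, c) ks).
  rewrite /long_endgame long_pieces_rem //=.
  case: (rem _ _) (@mem_rem _ (false, c) ks) r0 => //= k' s sub _.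
  by rewrite (chain k') // sub ?mem_head.
rewrite IHn //; first last.
- by have := tw0 _ kks; lia.
- by rewrite size_rem // sz.
by have := tw0 _ kks; rewrite tE /cost /weight /=; lia.
Qed.

(** Chains of length at least 4 and loops of length at least 6 lose two boxes net whatever the rest
    is worth, so only a 4-loop can bring a value below 2. *)
Lemma cost_ge2 k ks x : long_pieces ks -> k \in ks -> k != (true, 4%N) -> 2 <= cost k x.
Proof.
by move=> lks /(allP lks); rewrite /cost; case: k => -[] c /=; rewrite -?pair_eqE /=; lia.
Qed.

(** A negative total weight forces a 4-loop or a 6-loop, and opening one, a 4-loop if possible,
    costs at most 4. *)
Lemma long_endgame_value_le4 ks : long_endgame ks -> total_weight ks + 4 <= 2 -> W ks <= 4.
Proof.
elim: {ks}(size ks) {-2}ks (erefl (size ks)) => [|n IHn] ks sz lks cv2.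
  by case: ks sz lks cv2.
have [lp _] := andP lks.
have step c : (true, c) \in ks -> (c <= 8)%N ->
    W (rem (true, c) ks) = total_weight ks + 12 - c%:Z /\ 2 <= total_weight ks + 12 - c%:Z
    \/ 0 <= W (rem (true, c) ks) <= 4.
  move=> cks c8; have tE := total_weight_rem cks; have lr := long_endgame_rem_loop c lks.
  case: (lerP 2 (total_weight (rem (true, c) ks) + 4)) => h; [left|right].
    by rewrite long_endgame_value // tE /weight /=; rewrite tE /weight /= in h; lia.
  rewrite IHn ?size_rem ?sz // ?(ltW h) // andbT.
  by apply: endgame_value_ge0; apply: long_pieces_rem.
have [c4|no4] := boolP ((true, 4%N) \in ks).
  by have := endgame_value_le c4; have := step _ c4 isT; rewrite /cost /=; lia.
have [c6|no6] := boolP ((true, 6%N) \in ks).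
  (* Opening a 6-loop costs 2 + |x - 4|, which is at most 4 only for x between 2 and 6; the lower
     end holds because there is no 4-loop. *)
  have : 2 <= W (rem (true, 6%N) ks).
    have [k kr ->] := endgame_value_attained (rem_loop_neq0 6%N lks).
    apply: (cost_ge2 _ lp); first exact: mem_rem kr.
    by apply: contraNneq no4 => <-; apply: mem_rem kr.
  by have := endgame_value_le c6; have := step _ c6 isT; rewrite /cost /=; lia.
have : 0 <= total_weight ks; last by lia.
apply/total_weight_ge0/allP => k kks; apply: (long_piece_weight_ge0 lp kks).
  by apply: contraNneq no4 => <-.
by apply: contraNneq no6 => <-.
Qed.

(** * One 3-chain added to an endgame [H] without 3-chains *)

Lemma three_chain_weight H : total_weight ((false, 3%N) :: H) = total_weight H - 1.
Proof. by rewrite total_weight_cons /weight /=; lia. Qed.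

Lemma three_chain_open H : W ((false, 3%N) :: H) <= 1 + `|W H - 2|.
Proof. by have := endgame_value_le (mem_head (false, 3%N) H); rewrite /= /cost /=; lia. Qed.

Lemma three_chain_open_loop H : (true, 4%N) \in H ->
  W ((false, 3%N) :: H) <= `|W ((false, 3%N) :: rem (true, 4%N) H) - 4|.
Proof.
move=> h; have : (true, 4%N) \in (false, 3%N) :: H by rewrite inE h orbT.
by move=> /endgame_value_le; rewrite /cost /=; lia.
Qed.

Lemma three_chain_parity H : exists z : int, W ((false, 3%N) :: H) = total_weight H + 1 + z * 2.
Proof.
have [z ->] := endgame_value_parity ((false, 3%N) :: H).
by rewrite three_chain_weight; exists (z - 1); lia.
Qed.

Section OneThreeChain.
Variable H : seq (bool * nat).
Hypothesis lH : long_endgame H.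

Let lp : long_pieces H. Proof. by case/andP: lH. Qed.

Lemma three_chain_ge0 : 0 <= W ((false, 3%N) :: H).
Proof.
have [//|k kks ->] := @endgame_value_attained ((false, 3%N) :: H).
move: kks; rewrite inE => /predU1P[->|/(allP lp)]; first by rewrite /cost /=; lia.
by case: k => -[] c; rewrite /cost /=; lia.
Qed.

(** The controlled value with the 3-chain is [total_weight H + 3]: weight -1 and bonus 4. As [W H]
    is one more and so at least 3, opening the 3-chain meets the general lower bound. *)
Lemma three_chain_value : 2 <= total_weight H + 3 ->
  W ((false, 3%N) :: H) = total_weight H + 3.
Proof.
move=> h; have := three_chain_open H; rewrite (long_endgame_value lH); last by lia.
have := @endgame_value_lower ((false, 3%N) :: H) isT; rewrite three_chain_weight; lia.
Qed.

Lemma three_chain_le3 : total_weight H + 3 <= 1 -> W ((false, 3%N) :: H) <= 3.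
Proof.
move=> h; have := three_chain_open H; have := endgame_value_ge0 lp.
have := long_endgame_value_le4 lH; lia.
Qed.

Lemma three_chain_cases :
  W ((false, 3%N) :: H) = 1 + `|W H - 2| \/ 2 <= W ((false, 3%N) :: H) \/
  (true, 4%N) \in H /\
    W ((false, 3%N) :: H) = `|W ((false, 3%N) :: rem (true, 4%N) H) - 4|.
Proof.
have [//|k kks E] := @endgame_value_attained ((false, 3%N) :: H).
move: kks; rewrite inE => /predU1P[kE|kH].
  by left; rewrite E kE /= /cost /=; lia.
have [kE|ne] := eqVneq k (true, 4%N); last by right; left; rewrite E; apply: (cost_ge2 _ lp).
by right; right; rewrite E -{1}kE kH kE /cost /=; split=> //; lia.
Qed.

End OneThreeChain.

Lemma rem_loop4_weight H : (true, 4%N) \in H ->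
  total_weight (rem (true, 4%N) H) = total_weight H + 4.
Proof. by move=> h; rewrite total_weight_rem // /weight /=; lia. Qed.

Section OddEven.
Variable H : seq (bool * nat).
Hypothesis lH : long_endgame H.
Hypothesis c1 : total_weight H + 3 <= 1.

(** The value is even and at most 3, so it is 0 or 2. As [W H] is odd, opening the 3-chain costs at
    least 2; the value 0 thus needs a 4-loop whose removal leaves exactly 4, which exceeds 3 and so
    is a controlled value. *)
Lemma three_chain_even : (2 %| total_weight H + 3)%Z ->
  ((true, 4%N) \in H /\ total_weight H + 3 = 0 -> W ((false, 3%N) :: H) = 0) /\
  (~ ((true, 4%N) \in H /\ total_weight H + 3 = 0) -> W ((false, 3%N) :: H) = 2).
Proof.
move=> /dvdzP[q qE].
have [z zE] := three_chain_parity H; have le3 := three_chain_le3 lH c1.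
have ge0 := three_chain_ge0 lH; have [y yE] := endgame_value_parity H.
have lr := long_endgame_rem_loop 4%N lH.
split=> [[h4 c0]|nh].
  have := three_chain_open_loop h4; rewrite (three_chain_value lr) ?rem_loop4_weight //; lia.
have [| [|[h4]]] := three_chain_cases lH; try lia.
have tE := rem_loop4_weight h4; have nc0 : total_weight H + 3 <> 0 by move=> c0; apply: nh.
have := three_chain_value lr; have := three_chain_le3 lr; rewrite tE.
move: (W (_ :: rem _ _)) (W (_ :: H)) zE le3 ge0 => x w zE le3 ge0.
by clear nh; lia.
Qed.

Hypothesis c_odd : ~~ (2 %| total_weight H + 3)%Z.

Let c_oddE : exists q : int, total_weight H + 3 = q * 2 + 1.
Proof. exact: not_dvd2z. Qed.

Lemma three_chain_odd_2 : W H = 2 -> W ((false, 3%N) :: H) = 1.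
Proof.
move=> W2; have [q qE] := c_oddE; have [z zE] := three_chain_parity H.
have := three_chain_open H; have := three_chain_ge0 lH; lia.
Qed.

(** The value is 1 or 3, while [W H] is even and not 2, so opening the 3-chain costs at least 3. Any
    other opening costs at least 2, hence 3 by parity, unless it is that of a 4-loop. *)
Lemma three_chain_odd_not2 : W H <> 2 ->
  W ((false, 3%N) :: H) = 3 \/ (true, 4%N) \in H /\
    W ((false, 3%N) :: H) = `|W ((false, 3%N) :: rem (true, 4%N) H) - 4|.
Proof.
move=> W2; have [q qE] := c_oddE; have [z zE] := three_chain_parity H.
have [y yE] := endgame_value_parity H; have le3 := three_chain_le3 lH c1.
have [|[|]] := three_chain_cases lH; [|move=> ?; left; lia|by right].
by move=> E; left; lia.
Qed.

End OddEven.

(** The contrapositive carries the hypothesis [W H <> 2] to the endgame with one 4-loop fewer, as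
    the induction on 4-loops requires. *)
Lemma value2_of_rem_loop4 H : long_endgame H -> (true, 4%N) \in H ->
  W (rem (true, 4%N) H) = 2 -> (2 %| total_weight H)%Z -> W H = 2.
Proof.
move=> lH h4 r2 /dvdzP[q qE]; have [z zE] := endgame_value_parity H.
have [lp _] := andP lH; have := endgame_value_le h4; rewrite r2 /cost /=.
have [k kH E] := endgame_value_attained (long_endgame_neq0 lH).
have [kE|ne] := eqVneq k (true, 4%N); first by move: E; rewrite kE r2 /cost /=; lia.
by have := cost_ge2 (W (rem k H)) lp kH ne; lia.
Qed.

Lemma filter_rem (T : eqType) (x : T) (s : seq T) :
  filter (predC1 x) (rem x s) = filter (predC1 x) s.
Proof. by elim: s => //= y s IHs; case: eqVneq => //= ne; rewrite ?ne //= IHs. Qed.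

Lemma total_weight_filter_loop4 H :
  total_weight (filter (predC1 (true, 4%N)) H) =
  total_weight H + 4 * (count_mem (true, 4%N) H)%:Z.
Proof.
elim: H => [|k H IH]; first by rewrite /total_weight !big_nil.
by rewrite /=; case: eqVneq => [->|ne] /=; rewrite !total_weight_cons IH /weight /=; lia.
Qed.

Lemma long_endgame_filter_loop4 H : long_endgame H ->
  long_endgame (filter (predC1 (true, 4%N)) H).
Proof.
case/andP => h /hasP[k kH k1]; rewrite /long_endgame; apply/andP; split.
  exact: all_filter_sub.
apply/hasP; exists k => //; rewrite mem_filter kH andbT /=.
by apply: contraNneq k1 => ->.
Qed.

Lemma three_chain_loops4 H (d : int) : long_endgame H -> total_weight H + 3 <= 1 ->
  ~~ (2 %| total_weight H + 3)%Z -> W H <> 2 -> (1 <= count_mem (true, 4%N) H)%N ->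
  0 <= d <= 7 ->
  (d = W ((false, 3%N) :: filter (predC1 (true, 4%N)) H) %[mod 8])%Z ->
  W ((false, 3%N) :: H) = if odd (count_mem (true, 4%N) H) then `|4 - d| else 4 - `|4 - d|.
Proof.
move: {2}(count_mem _ _) (erefl (count_mem (true, 4%N) H)) => f fE.
elim: f H fE => [|f IHf] H fE lH c1 c_odd W2 f1 hd dE; first by rewrite fE in f1.
have h4 : (true, 4%N) \in H by rewrite -has_pred1 has_count fE.
have lr := long_endgame_rem_loop 4%N lH; have tE := rem_loop4_weight h4.
have fr : count_mem (true, 4%N) (rem (true, 4%N) H) = f by rewrite count_mem_rem fE eqxx subn1.
have le4 := three_chain_open_loop h4; have le3 := three_chain_le3 lH c1.
have step := three_chain_odd_not2 lH c1 c_odd W2.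
have [q qE] := not_dvd2z c_odd.
have [y yE] := endgame_value_parity H.
have [z zE] := three_chain_parity (rem (true, 4%N) H).
have xge0 := three_chain_ge0 lr; have xle3 := three_chain_le3 lr.
have xval := three_chain_value lr; rewrite tE in zE xle3 xval.
(* This is the controlled value without one 4-loop. If it is at least 2, it is 3 or 5, as the
   original one is odd and at most 1; opening the loop then yields 1, and the value without any
   4-loop is a controlled value too. *)
have [big|small] := lerP 2 (total_weight H + 4 + 3).
  have KE := three_chain_value (long_endgame_filter_loop4 lH).
  rewrite total_weight_filter_loop4 fE in KE; rewrite KE in dE; last by lia.
  (* Only the parity of the number of 4-loops matters for four times that number modulo 8. *)
  have oddE : f.+1 = (odd f.+1 + (f.+1)./2.*2)%N by rewrite odd_double_half.
  rewrite fE; have {}xval := xval big; rewrite xval in le4 step.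
  have dE' : exists r : int, d = total_weight H + 4 * f.+1%:Z + 3 + r * 8.
    have := divz_eq d 8; have := divz_eq (total_weight H + 4 * f.+1%:Z + 3) 8; rewrite -dE => h1 h2.
    exists ((d %/ 8)%Z - ((total_weight H + 4 * f.+1%:Z + 3) %/ 8)%Z); lia.
  case: dE' => r rE; clear - rE oddE c1 big qE hd le4 le3 step.
  have Wx : W ((false, 3%N) :: H) = `|total_weight H + 4 + 3 - 4| by case: step => [|[]]; lia.
  by rewrite Wx; case: (odd f.+1) oddE => oddE; lia.
have Wr : W (rem (true, 4%N) H) <> 2.
  by move=> W2r; apply/W2/(value2_of_rem_loop4 lH) => //; apply/dvdzP; exists (q - 1); lia.
have r1 : total_weight (rem (true, 4%N) H) + 3 <= 1 by lia.
have r_odd : ~~ (2 %| total_weight (rem (true, 4%N) H) + 3)%Z by rewrite tE; lia.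
have {}xle3 : W ((false, 3%N) :: rem (true, 4%N) H) <= 3 by apply: xle3; lia.
rewrite -(filter_rem (true, 4%N) H) in dE; rewrite fE.
(* If the opened loop was the only 4-loop, the rest is worth 3, so d = 3 and the value is |4 - 3| =
   1. *)
have [f0|f_gt0] := posnP f.
  have no4 : (true, 4%N) \notin rem (true, 4%N) H by rewrite -has_pred1 has_count fr f0.
  have x3 : W ((false, 3%N) :: rem (true, 4%N) H) = 3.
    have := three_chain_odd_not2 lr r1 r_odd Wr; rewrite (negPf no4).
    by case=> // -[].
  rewrite (all_filterP _) in dE; last first.
    by apply/allP => k kr /=; apply: contraNneq no4 => kE; rewrite -{1}kE.
  rewrite x3 in dE le4 step; rewrite f0 /=.
  have d3 : d = 3 by lia.
  by case: step => [|[]]; lia.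
have := IHf _ fr lr r1 r_odd Wr; rewrite fr => /(_ f_gt0 hd dE) xE.
have {}step : W ((false, 3%N) :: H) = 3 \/
    W ((false, 3%N) :: H) = `|W ((false, 3%N) :: rem (true, 4%N) H) - 4|.
  by case: step => [|[]]; [left|right].
(* The value x without the 4-loop is odd and between 0 and 3, hence 1 or 3. The bounds on w then
   leave only w = 4 - x, which exchanges the two formulas. *)
move: (W (_ :: rem _ _)) (W (_ :: H)) zE qE xge0 xle3 xE le4 le3 step hd => x w.
by clear => zE qE xge0 xle3 xE le4 le3 step hd; rewrite /=; case: (odd f) xE => /= xE; lia.
Qed.

(** * From simple loony endgames to multisets of components *)

Definition pieces (cs ls : seq nat) : seq (bool * nat) :=
  map (pair false) cs ++ map (pair true) ls.

Lemma v_pieces G : v G = endgame_value (pieces (chains G) (loops G)).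
Proof.
rewrite -value_piece_games /v /endgame_game; first by rewrite map_cat -!map_comp.
rewrite all_cat !all_map; apply/andP; split; first exact: chains_ok.
by apply: sub_all (loops_ok G) => l /andP[].
Qed.

Lemma fcv_pieces G : fcv G = total_weight (pieces (chains G) (loops G)).
Proof. by rewrite /total_weight big_cat !big_map. Qed.

Lemma total_weight_perm ks ks' : perm_eq ks ks' -> total_weight ks = total_weight ks'.
Proof. exact: perm_big. Qed.

Lemma perm_pieces3 (cs ls : seq nat) : 3%N \in cs ->
  perm_eq (pieces cs ls) ((false, 3%N) :: pieces (rem 3%N cs) ls).
Proof.
by move=> h; rewrite -cat_cons perm_cat2r; apply: (perm_map (pair false) (perm_to_rem h)).
Qed.

Lemma count_loop_pieces n cs ls : count_mem (true, n) (pieces cs ls) = count_mem n ls.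
Proof.
rewrite count_cat !count_map (eq_count (a2 := pred0)) ?count_pred0 //.
Qed.

Lemma mem_loop_pieces n cs ls : ((true, n) \in pieces cs ls) = (n \in ls).
Proof. by rewrite -!has_pred1 !has_count count_loop_pieces. Qed.

Lemma filter_loop_pieces n cs ls :
  filter (predC1 (true, n)) (pieces cs ls) = pieces cs (filter (predC1 n) ls).
Proof.
rewrite filter_cat !filter_map; congr cat; congr map.
by rewrite (eq_filter (a2 := predT)) ?filter_predT.
Qed.

Lemma tb_long_chain G : has (fun c => 4 <= c)%N (chains G) -> tb G = 4.
Proof. by rewrite /tb => h; case: (chains G) h => // c cs ->. Qed.

Unset Implicit Arguments.

Theorem corollary27 (G : simple_loony_endgame)
    (one_3_chain : count_mem 3%N (chains G) = 1%N)
    (long_chain : exists2 n : nat, n \in chains G & (4 <= n)%N) :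
  [/\ (* (a) *)
      2 <= cv G -> v G = cv G,
      (* (b) *)
      cv G <= 1 -> (2 %| cv G)%Z ->
        (4%N \in loops G /\ cv (remove_loop 4%N G) = 4 -> v G = 0) /\
        (~ (4%N \in loops G /\ cv (remove_loop 4%N G) = 4) -> v G = 2),
      (* (c) *)
      cv G <= 1 -> ~~ (2 %| cv G)%Z -> v (remove_chain 3%N G) = 2 -> v G = 1,
      (* (d) *)
      cv G <= 1 -> ~~ (2 %| cv G)%Z -> v (remove_chain 3%N G) <> 2 ->
        4%N \notin loops G -> v G = 3
    & (* (e) *)
      cv G <= 1 -> ~~ (2 %| cv G)%Z -> v (remove_chain 3%N G) <> 2 ->
        forall f : nat, f = count_mem 4%N (loops G) -> (1 <= f)%N ->
        forall d : int, 0 <= d <= 7 ->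
        (d = v (remove_all_loops 4%N G) %[mod 8])%Z ->
          (odd f -> v G = `|4 - d|) /\ (~~ odd f -> v G = 4 - `|4 - d|)].
Proof.
have c3 : 3%N \in chains G by rewrite -has_pred1 has_count one_3_chain.
have has4 : has (fun c => 4 <= c)%N (chains G) by apply/hasP.
pose H := pieces (rem 3%N (chains G)) (loops G).
have lH : long_endgame H.
  rewrite /long_endgame /long_pieces all_cat has_cat !all_map !has_map -andbA.
  apply/and3P; split.
  - apply/allP => c cr /=; have := allP (chains_ok G) _ (mem_rem cr).
    rewrite andbT leq_eqVlt => /predU1P[cE|//]; rewrite -cE in cr.
    have : (0 < count_mem 3%N (rem 3%N (chains G)))%N by rewrite -has_count has_pred1.
    by rewrite count_mem_rem one_3_chain.
  - exact: loops_ok.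
  case: long_chain => n nG n4; apply/orP; left; apply/hasP; exists n => //.
  by apply: rem_mem => //; apply: contraTneq n4 => ->.
have vG : v G = endgame_value ((false, 3%N) :: H).
  by rewrite v_pieces; apply/endgame_value_perm/perm_pieces3.
have cvG : cv G = total_weight H + 3.
  rewrite /cv tb_long_chain // fcv_pieces (total_weight_perm (perm_pieces3 _ c3)).
  by rewrite three_chain_weight -addrA.
have vH : v (remove_chain 3%N G) = endgame_value H by rewrite v_pieces.
have loopH : ((true, 4%N) \in H) = (4%N \in loops G) := mem_loop_pieces _ _ _.
have cv_rem : 4%N \in loops G -> cv (remove_loop 4%N G) = total_weight H + 3 + 4.
  move=> h; rewrite -cvG /cv !tb_long_chain //; congr (_ + _).
  rewrite [in RHS]/fcv (big_rem _ h) /fcv /=.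
  by move: (\sum_(c <- _) _) (\sum_(l <- rem _ _) _) => x y; lia.
rewrite vG vH cvG; split=> [c2|c1 ev|c1 od W2|c1 od W2 no4|c1 od W2 f fE f1 d hd dE].
- exact: three_chain_value.
- have [h0 h2] := three_chain_even lH c1 ev; rewrite loopH in h0 h2.
  split=> h; first by case: h => h4 c4; apply: h0; rewrite cv_rem // in c4; split=> //; lia.
  by apply: h2 => -[h4 c0]; apply: h; rewrite cv_rem // c0.
- exact: three_chain_odd_2.
- by case: (three_chain_odd_not2 lH c1 od W2) => // -[]; rewrite loopH (negPf no4).
have countH : count_mem (true, 4%N) H = f by rewrite fE; apply: count_loop_pieces.
have K : v (remove_all_loops 4%N G) =
    endgame_value ((false, 3%N) :: filter (predC1 (true, 4%N)) H).
  by rewrite v_pieces filter_loop_pieces; apply/endgame_value_perm/perm_pieces3.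
have := three_chain_loops4 lH c1 od W2; rewrite countH => /(_ d f1 hd).
by rewrite -K => /(_ dE) ->; case: (odd f).
Qed.
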